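(* Let $\mathcal F\subset\mathcal F_0$, $\tau\ge1$, $\xi=(R,K,d_1,E,\theta_{\mathrm{NC}},\theta_1,\theta_2,\theta_3)\in\Xi$, $\beta\in(0,D_{\mathrm{proj}})$, $\beta_0\ge0$, and $n\in\mathbb N\setminus\{1\}$. Let $P\in\mathcal P_{\tau,\xi}$, and let $U_1,\dots,U_n$ be i.i.d. random variables following $P$; write $U_1^n=(U_1,\dots,U_n)$. Then there are positive constants $C,C',C''$ that are independent of $n$ and $P$, such that for any estimator $\widehat f^{\mathrm{local}}_{n,P}:(\mathcal X^2\times\mathcal Y)^n\to\mathfrak F_{\beta,\beta_0,P}(\mathcal F)\subset\mathcal F_0$ and $\widehat g^{\mathrm{local}}_{n,P}=(\widehat g^{\mathrm{local}}_{n,P,1},\dots,\widehat g^{\mathrm{local}}_{n,P,d_1}):(\mathcal X^2\times\mathcal Y)^n\to\mathcal G_0$ with $\widehat f^{\mathrm{local}}_{n,P}=\sum_{i=1}^{d_1}\widehat g^{\mathrm{local}}_{n,P,i}v_i$, we have $$\mathcal R(\widehat g^{\mathrm{local}}_{n,P};P)\le C(\log n)\,\mathbb E\big[\mathcal E(\widehat f^{\mathrm{local}}_{n,P}(U_1^n);P)\big]^{\frac1\tau}+C'\beta_0+\frac{C''}{n},$$ where $\mathcal E(f;P)=\mathbb E_P[\ell_f]-\mathbb E_P[\ell_{f^*}]$ is the excess risk of $f\in\mathfrak F_{\beta,\beta_0,P}(\mathcal F)$ with respect to the contrastive function $f^*$ of $P$.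
   Context: **Basic notation.** $\mathcal X=[0,1]^K$ with Lebesgue measure $\mu$; $\mathcal Y=\{-1,1\}$ with counting measure $\chi$. For a Borel probability measure $P$ on $\mathcal X^2\times\mathcal Y$ with density $p(x,x',y)$ w.r.t. $\mu\otimes\mu\otimes\chi$: $p_{X,X'}(x,x')=p(x,x',1)+p(x,x',-1)$; $p_X,p_{X'}$ are the two marginals of $p_{X,X'}$ on $\mathcal X$; $p_Y(y)=\int_{\mathcal X^2}p(x,x',y)\,d\mu\,d\mu$; $q(x,x')=p(x,x'|y=1)$; $\eta(x,x')=p(y=1|x,x')=p(x,x',1)/p_{X,X'}(x,x')$. $P_X$, $P_{X,X'}$ denote the measures with Lebesgue densities $p_X$, $p_{X,X'}$. **Smooth partitions.** $\mathcal C_R^{\alpha,K-1}$ is the set of $\lceil\alpha-1\rceil$-times differentiable $h:[0,1]^{K-1}\to\mathbb R$ with $\|h\|_{\mathcal C^{\alpha,K-1}}=\sum_{\|\mathbf s\|_1\le\lceil\alpha-1\rceil}\|\partial_{\mathbf s}h\|_\infty+\sum_{\|\mathbf s\|_1=\lceil\alpha-1\rceil}\sup_{x\ne x'}\frac{|\partial_{\mathbf s}h(x)-\partial_{\mathbf s}h(x')|}{\|x-x'\|_\infty^{\alpha-\lceil\alpha-1\rceil}}\le R$ (multi-indices $\mathbf s\in\mathbb N_0^{K-1}$). For $2^E\ge d_1$, $\mathfrak P^{K,d_1,E}_{\alpha,R}$ is the set of sequences $\{\mathcal K_i\}_{i=1}^{d_1}$ of pairwise disjoint (possibly empty) sets with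 union $\mathcal X$ for which there are a partition of $\{1,-1\}^E$ into disjoint sets $\mathcal I_1,\dots,\mathcal I_{d_1}$, functions $h_1,\dots,h_E\in\mathcal C_R^{\alpha,K-1}$ and indices $j_1,\dots,j_E\in\{1,\dots,K\}$ with $\mathcal K_i=\bigcup_{(s_1,\dots,s_E)\in\mathcal I_i}\bigcap_{k=1}^E\mathcal L_{s_k,h_k,j_k}$, where $\mathcal L_{1,h,j}=\{x\in\mathcal X: x_j\ge h(x_{\setminus j})\}$, $\mathcal L_{-1,h,j}=\{x\in\mathcal X:x_j<h(x_{\setminus j})\}$, and $x_{\setminus j}$ is $x$ with coordinate $j$ removed. **Noise condition.** $P$ satisfies $\tau$-(NC) with $\theta_{\mathrm{NC}}\in(0,1]$ if: either $\tau>1$ and there is $c\in[1,\theta_{\mathrm{NC}}^{-1}]$ with $P_{X,X'}(|2\eta-1|\le s)\le c\,s^{1/(\tau-1)}$ for all $s\in(0,1]$; or $\tau=1$ and there is $s_0\in[\theta_{\mathrm{NC}},1]$ such that the same inequality holds for all $s\in(0,s_0]$ and any $c\ge1$, where for $\tau=1$ the expression $s^{1/(\tau-1)}$ is read as $s^{+\infty}$ ($0$ for $0<s<1$, $1$ for $s=1$). **Class of distributions.** $\Xi$ is the set of $\xi=(R,K,d_1,E,\theta_{\mathrm{NC}},\theta_1,\theta_2,\theta_3)$ with $R\ge1$, $K,d_1,E\in\mathbb N$, $2^E\ge d_1$, $\theta_{\mathrm{NC}}\in(0,1]$, $0<\theta_2\le\frac12\le\theta_3<1\le\theta_1$; here $d_1\ge2$.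 $\mathcal P_{\alpha,\tau,\xi}$ is the set of Borel probability measures $P$ on $\mathcal X^2\times\mathcal Y$ such that: (A1) $P\ll\mu\otimes\mu\otimes\chi$, $p(x,x',1)=p_Y(1)q(x,x')$ and $p(x,x',-1)=p_Y(-1)p_X(x)p_{X'}(x')$, where $p_X,p_{X'}$ are the marginals of $q$; (A2) $P$ satisfies $\tau$-(NC) with $\theta_{\mathrm{NC}}$; (A3) $q$ is symmetric, $\|q\|_{L^\infty(\mathcal X^2)}\le\theta_1^2$, $p_X,p_{X'}$ are positive and continuous on $\mathcal X$ with sup-norms $\le\theta_1$, and $p_Y(-1)\in[\theta_2,1)$; (A4) there is $\{\mathcal K_i\}_{i=1}^{d_1}\in\mathfrak P^{K,d_1,E}_{\alpha,R}$ with $P_X(\mathcal K_i)\le\theta_3$ for all $i$ and $\{(x,x')\in\mathcal X^2:\eta(x,x')\ge\frac12\}=\bigcup_{i=1}^{d_1}\mathcal K_i\times\mathcal K_i$. $\mathcal P_{\tau,\xi}=\bigcup_{\alpha>0}\mathcal P_{\alpha,\tau,\xi}$, $\mathcal P_\xi=\bigcup_{\tau\ge1}\mathcal P_{\tau,\xi}$. A map $P\mapsto\mathcal S_P=\{\mathcal K_i\}_{i=1}^{d_1}$ assigning to each $P\in\mathcal P_\xi$ a sequence as in (A4) is fixed. **Simplex.** $d=d_1-1$; $v_1,\dots,v_{d_1}$ are unit vectors in $\mathbb R^d$ with $\sum_iv_i=0$ and all pairwise distances equal; $\Delta^d$ is their convex hull, $D_{\Delta^d}$ its diameter. $D_{\mathrm{proj}}$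 is the distance from $v_1$ to the convex hull of $v_2,\dots,v_{d_1}$. $\mathcal F_0$ is the set of $f:\mathcal X\to\Delta^d$, $f=\sum_ig_iv_i$, whose (unique) barycentric coordinates $g_i:\mathcal X\to[0,1]$, $\sum_ig_i=1$, are measurable. $\mathcal G_0$ is the set of $g=(g_1,\dots,g_{d_1}):\mathcal X\to[0,1]^{d_1}$ with measurable components and $\sum_ig_i\equiv1$. **Contrastive function and localized subclass.** For $P\in\mathcal P_\xi$ with $\mathcal S_P=\{\mathcal K_i\}$, $f^*=\sum_{i=1}^{d_1}\mathbf 1_{\mathcal K_i}v_i$. For $\mathcal F\subset\mathcal F_0$, $\beta>0$, $\beta_0\ge0$: $\mathfrak F_{\beta,\beta_0,P}(\mathcal F)=\{f\in\mathcal F: P_X(\{x:\|f(x)-f^*(x)\|_2<\beta\})\ge1-\beta_0\}$. **Loss.** $\rho_f(x,x')=\|f(x)-f(x')\|_2^2$, $\psi(s)=1-2D_{\Delta^d}^{-2}s$, $\ell_f(x,x',y)=\max\{0,1-y\,\psi(\rho_f(x,x'))\}$. **Risk.** For an estimator $\widehat g_n:(\mathcal X^2\times\mathcal Y)^n\to\mathcal G_0$, $\mathcal S_P=\{\mathcal K_i\}$ and $U_1,\dots,U_n$ i.i.d. from $P$, $\mathcal R(\widehat g_n;P)=\mathbb E\big[\sum_{i=1}^{d_1}\|\widehat g_{n,i}(U_1^n)-\mathbf 1_{\mathcal K_i}\|^2_{L^2(\mathcal X,P_X)}\big]$. *)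

(* Defs.v *)
From HB Require Import structures.
From mathcomp Require Import all_boot all_order all_algebra.
From mathcomp Require Import all_classical all_reals all_analysis measurable_realfun.
Import Order.TTheory GRing.Theory Num.Theory.
Import numFieldNormedType.Exports.

Set Implicit Arguments.
Unset Strict Implicit.
Unset Printing Implicit Defensive.

Local Open Scope classical_set_scope.
Local Open Scope ring_scope.

(* The cube [0,1]^k, as a type, with the topology induced by 'rV[R]_k and the
   corresponding Borel sigma-algebra. *)
Section cube_space.
Variables (R : realType) (k : nat).

Definition cube_set : set 'rV[R]_k := [set x | forall i, 0 <= x 0 i <= 1].

Definition cube : Type := set_type cube_set.

HB.instance Definition _ := Topological.copy cube (set_type cube_set).

Definition cval (x : cube) : 'rV[R]_k := \val x.

Definition clamp (t : R) : R := Num.max 0 (Num.min 1 t).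

Lemma clamp_in (t : k.-tuple R) :
  (\row_i clamp (tnth t i)) \in cube_set.
Proof.
rewrite inE /cube_set/= => i; rewrite mxE /clamp le_max lexx/=.
by rewrite ge_max ler01/= ge_min lexx.
Qed.

Definition cube_of_tuple (t : k.-tuple R) : cube :=
  SigSub (clamp_in t).

HB.instance Definition _ := isPointed.Build cube (cube_of_tuple [tuple of nseq k 0]).

Let borel : set_system cube := <<s open >>.
Let borel0 : borel set0. Proof. exact: sigma_algebra0. Qed.
Let borelC A : borel A -> borel (~` A). Proof. exact: sigma_algebraC. Qed.
Let borelU (F : (set cube)^nat) :
  (forall i, borel (F i)) -> borel (\bigcup_i F i).
Proof. exact: sigma_algebra_bigcup. Qed.

Definition cube_display : measure_display. Proof. exact: default_measure_display. Qed.

HB.instance Definition _ := @isMeasurable.Build cube_display cube borel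
  borel0 borelC borelU.

End cube_space.
Arguments cube_set : clear implicits.
Arguments cube : clear implicits.

Section lebesgue.
Variable R : realType.

Lemma measurable_clamp : measurable_fun setT (@clamp R).
Proof.
by apply: measurable_maxr => //; exact: measurable_minr.
Qed.

Lemma measurable_cube_of_tuple k :
  measurable_fun setT (@cube_of_tuple R k).
Proof.
apply: (@measurability _ _ _ _ _ _ (@open (cube R k))) => //.
move=> _ [U [V oV VU] <-]; rewrite setTI.
pose box (q : {ffun 'I_k -> rat} * nat) : set (k.-tuple R) :=
  \bigcap_(i in [set: 'I_k])
    ((fun t => tnth t i) @^-1` (@clamp R @^-1` ball (ratr (q.1 i) : R) q.2.+1%:R^-1)).
pose D := [set q | box q `<=` (@cube_of_tuple R k) @^-1` U].
rewrite (_ : _ @^-1` U = \bigcup_(q in D) box q).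
  rewrite bigcup_mkcond; apply: countable_bigcupT_measurable => // q.
  case: ifPn => // _; apply: fin_bigcap_measurable => // i _.
  have mb : measurable (@clamp R @^-1` ball (ratr (q.1 i) : R) q.2.+1%:R^-1).
    rewrite -[X in measurable X]setTI; apply: measurable_clamp => //.
    exact: open_measurable (ball_open _ _).
  by rewrite -[X in measurable X]setTI; exact: measurable_tnth.
apply/seteqP; split => [t /= Ut|t [q Dq] /Dq//].
have Vt : V (cval (cube_of_tuple t)) by rewrite -[_ (cval _)]/((set_val @^-1` V) _) VU.
have /nbhs_ballP[e /= e0 eV] := open_nbhs_nbhs (conj oV Vt).
have [n ne] : exists n, n.+1%:R^-1 < e / 2 :> R.
  exists (Num.Def.trunc ((e / 2)^-1)).
  by rewrite invf_plt ?posrE ?divr_gt0// Num.Theory.truncnS_gt.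
have aq (i : 'I_k) : exists q : rat, `|ratr q - clamp (R:=R) (tnth t i)| < n.+1%:R^-1.
  have lt_t : clamp (tnth t i) - n.+1%:R^-1 < clamp (tnth t i).
    by rewrite ltrBlDr ltrDl invr_gt0.
  have [q] := rat_in_itvoo lt_t.
  rewrite in_itv/= => /andP[q1 q2]; exists q.
  rewrite ltr_distl; apply/andP; split; [exact: q1|].
  by apply: (lt_trans q2); rewrite ltrDl invr_gt0.
have [q qP] := choice aq.
exists ([ffun i => q i], n).
  move=> t' bt'; rewrite /= -VU; apply: eV; split => // i j.
  rewrite /cube_of_tuple/= !mxE.
  have := bt' j I; rewrite /ball/= ffunE => h.
  have := qP j; rewrite distrC => h2.
  have := ltrD h2 h => h3.
  apply: (le_lt_trans (ler_distD (ratr (q j)) _ _)).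
  by apply: (lt_trans h3); rewrite [ltRHS](splitr e) ltrD.
by move=> i _ /=; rewrite /ball/= ffunE.
Qed.

HB.instance Definition _ k := isMeasurableFun.Build _ _ _ _
  (@cube_of_tuple R k) (@measurable_cube_of_tuple k).

End lebesgue.

Section tuple_probability.
Context d (T : measurableType d) (R : realType).

Definition pair_cons n (x : T * n.-tuple T) : n.+1.-tuple T :=
  [tuple of x.1 :: x.2].

Lemma measurable_pair_cons n : measurable_fun setT (@pair_cons n).
Proof. by apply: measurable_cons. Qed.

HB.instance Definition _ n := isMeasurableFun.Build _ _ _ _
  (@pair_cons n) (@measurable_pair_cons n).

Fixpoint tuple_prob (P : probability T R) n : probability (n.-tuple T) R :=
  if n is m.+1 then distribution (P \x tuple_prob P m)%E (@pair_cons m)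
  else dirac ([tuple] : 0.-tuple T).

Arguments tuple_prob P n : clear implicits.

Lemma tuple_prob_rect (P : probability T R) n (A : 'I_n -> set T) :
  (forall i, measurable (A i)) ->
  tuple_prob P n [set t | forall i, A i (tnth t i)] = (\prod_i P (A i))%E.
Proof.
elim: n A => [A _|n ih A mA] /=.
  by rewrite big_ord0 diracE mem_set//= => -[].
rewrite big_ord_recl -ih; last by move=> i; exact: mA.
rewrite -product_measure1E//; last first.
  have -> : [set t | forall i, A (lift ord0 i) (tnth t i)] =
     \bigcap_(i in [set: 'I_n]) ((fun t : n.-tuple T => tnth t i) @^-1` A (lift ord0 i)).
    by apply/seteqP; split => t /= h i; [move=> _; exact: h|exact: (h i I)].
  apply: fin_bigcap_measurable => // i _.
  by rewrite -[X in measurable X]setTI; exact: measurable_tnth.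
rewrite /distribution /pushforward; congr (_ _).
apply/seteqP; split => -[x t] /= h.
  split; first exact: (h ord0).
  by move=> i; have := h (lift ord0 i); rewrite tnthS.
by move=> i; case: (unliftP ord0 i) => [j ->|->]; [rewrite tnthS; exact: h.2|exact: h.1].
Qed.

End tuple_probability.
Arguments tuple_prob {d T R} P n.

Section lebesgue_cube.
Variables (R : realType) (k : nat).

(* [uniform_prob] lives on [measurableTypeR R]; [toR] only changes the carrier
   to the canonical measurable structure of [R]. *)
Definition toR : measurableTypeR R -> R := idfun.

Lemma measurable_toR : measurable_fun setT toR.
Proof. exact: (@measurable_id _ _ setT). Qed.

HB.instance Definition _ := isMeasurableFun.Build _ _ _ _ toR measurable_toR.

Definition lebesgue01 : probability R R :=
  distribution (uniform_prob (@ltr01 R)) toR.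

(* Only the null set outside [0,1]^k is affected by the clamping done by
   [cube_of_tuple]. *)
Definition lebesgue_cube : probability (cube R k) R :=
  distribution (tuple_prob lebesgue01 k) (@cube_of_tuple R k).

(* Together with the coordinate boxes being a pi-system generating the Borel
   sets, this identifies [lebesgue_cube] as the Lebesgue measure on [0,1]^k. *)
Lemma lebesgue_cube_box (a b : 'I_k -> R) :
  (forall i, 0 <= a i <= b i) -> (forall i, b i <= 1) ->
  lebesgue_cube [set x | forall i, a i <= cval x 0 i <= b i] =
  (\prod_i (b i - a i))%:E.
Proof.
move=> a0b b1.
rewrite -prodEFin.
transitivity (tuple_prob lebesgue01 k [set t | forall i,
    [set x : R | a i <= clamp x <= b i] (tnth t i)]).
  rewrite /lebesgue_cube /distribution /pushforward; congr (tuple_prob _ _ _).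
  by apply/seteqP; split => t /= h i; have := h i; rewrite mxE.
have mA i : measurable [set x : R | a i <= clamp x <= b i].
  have -> : [set x : R | a i <= clamp x <= b i] = @clamp R @^-1` `[a i, b i].
    by apply/seteqP; split => x; rewrite /= in_itv.
  by rewrite -[X in measurable X]setTI; exact: measurable_clamp.
rewrite (tuple_prob_rect lebesgue01 mA); apply: eq_bigr => i _.
have /andP[a0 ab] := a0b i.
rewrite /lebesgue01/= /distribution /pushforward /= /uniform_prob integral_uniform_pdf.
transitivity (\int[lebesgue_measure]_(x in `[a i, b i]) (cst 1 x))%E.
  have -> : [set x : R | a i <= clamp x <= b i] `&` `[0, 1] = [set` `[a i, b i]].
    apply/seteqP; split => x /=; rewrite !in_itv/=.
      move=> [] + /andP[x0 x1].
      by rewrite /clamp (min_idPr x1) (max_idPr x0).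
    move=> /andP[ax xb].
    have x0 : 0 <= x by exact: le_trans ax.
    have x1 : x <= 1 by exact: le_trans (b1 i).
    by rewrite x0 x1 /clamp (min_idPr x1) (max_idPr x0) ax xb.
  apply: eq_integral => x; rewrite inE/= in_itv/= => /andP[ax xb].
  by rewrite /uniform_pdf (le_trans a0 ax) (le_trans xb (b1 i)) subr0 invr1.
rewrite integral_cst//= mul1e lebesgue_measure_itv/= lte_fin.
case: ltP => // ba; have -> : b i = a i by apply/eqP; rewrite eq_le ab ba.
by rewrite subrr.
Qed.

End lebesgue_cube.

(* Functions on [0,1]^k are represented by total functions on 'rV[R]_k of which
   only the values on [cube_set R k] matter; derivatives are one-sided on the
   boundary. *)
Section hoelder_class.
Variables (R : realType) (k : nat).
Implicit Types (h : 'rV[R]_k -> R) (alpha : R).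

Definition differentiable_on_cube h : Prop :=
  forall x, cube_set R k x -> exists L : {linear 'rV[R]_k -> R^o},
    forall e : R, 0 < e ->
      \forall y \near within (cube_set R k) (nbhs x),
        `|h y - h x - L (y - x)| <= e * `|y - x|.

Definition partial (j : 'I_k) h : 'rV[R]_k -> R := fun x =>
  lim ((fun t : R => t^-1 * (h (x + t *: delta_mx 0 j) - h x)) @
    within [set t : R | cube_set R k (x + t *: delta_mx 0 j)] 0^').

Fixpoint ntimes_differentiable m h : Prop :=
  if m is m'.+1 then differentiable_on_cube h /\
    forall j, ntimes_differentiable m' (partial j h)
  else True.

Definition partial_multi m (s : {ffun 'I_k -> 'I_m.+1}) h : 'rV[R]_k -> R :=
  foldr (fun j f => iter (s j) (partial j) f) h (enum 'I_k).

Definition multi_order m (s : {ffun 'I_k -> 'I_m.+1}) : nat := (\sum_j s j)%N.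

Definition sup_norm h : \bar R :=
  ereal_sup [set `|h x|%:E | x in cube_set R k].

(* The maximum with 0 only matters for k = 0, where there are no x <> x'. *)
Definition hoelder_seminorm (a : R) h : \bar R :=
  maxe 0%:E (ereal_sup [set z | exists x x', [/\ cube_set R k x, cube_set R k x',
    x != x' & z = (`|h x - h x'| / `|x - x'| `^ a)%:E]]).

(* ceil (alpha - 1), a natural number for alpha > 0 *)
Definition hoelder_order alpha : nat := `|Num.ceil (alpha - 1)|%N.

Definition hoelder_norm alpha h : \bar R :=
  let m := hoelder_order alpha in
  (\sum_(s : {ffun 'I_k -> 'I_m.+1} | (multi_order s <= m)%N)
      sup_norm (partial_multi s h) +
   \sum_(s : {ffun 'I_k -> 'I_m.+1} | multi_order s == m)
      hoelder_seminorm (alpha - m%:R) (partial_multi s h))%E.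

Definition hoelder_class (r alpha : R) : set ('rV[R]_k -> R) :=
  [set h | ntimes_differentiable (hoelder_order alpha) h /\
           (hoelder_norm alpha h <= r%:E)%E].

End hoelder_class.

Section smooth_partitions.
Variables (R : realType) (K : nat).
Local Notation X := (cube R K).

(* The sign s in {1,-1} is encoded by a boolean, true standing for 1. *)
Definition halfspace (s : bool) (h : 'rV[R]_K.-1 -> R) (j : 'I_K) : set X :=
  if s then [set x | h (col' j (cval x)) <= cval x 0 j]
  else [set x | cval x 0 j < h (col' j (cval x))].

Definition smooth_partition (d1 E : nat) (alpha r : R) : set ('I_d1 -> set X) :=
  [set S | [/\ trivIset setT S, \bigcup_i S i = setT &
    exists (I : 'I_d1 -> set {ffun 'I_E -> bool})
           (h : 'I_E -> 'rV[R]_K.-1 -> R) (j : 'I_E -> 'I_K),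
    [/\ trivIset setT I, \bigcup_i I i = setT,
        forall k, hoelder_class r alpha (h k) &
        forall i, S i =
          \bigcup_(s in I i) \bigcap_(k in [set: 'I_E])
             halfspace (s k) (h k) (j k)]]].

End smooth_partitions.

(* d_1 is represented as [sdim.+1], where [sdim] is the dimension d of the
   simplex. *)
Record params (R : realType) := Params {
  radius : R;
  dimX : nat;
  sdim : nat;
  depth : nat;
  thetaNC : R;
  theta1 : R;
  theta2 : R;
  theta3 : R }.

Definition Xi {R : realType} (xi : params R) : Prop :=
  [/\ 1 <= radius xi,
      [/\ (0 < dimX xi)%N, (0 < sdim xi)%N, (0 < depth xi)%N &
          ((sdim xi).+1 <= 2 ^ depth xi)%N],
      0 < thetaNC xi <= 1,
      0 < theta2 xi <= 1 / 2 &
      1 / 2 <= theta3 xi < 1 /\ 1 <= theta1 xi].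

(* X * X * Y, with the label 1 (resp. -1) encoded by true (resp. false) *)
Notation sample R K := (cube R K * cube R K * bool)%type.

Definition label {R : realType} (y : bool) : R := if y then 1 else -1.

Section distributions.
Variables (R : realType) (K : nat).
Local Notation X := (cube R K).
Local Notation Z := (sample R K).
Local Notation mu := (@lebesgue_cube R K).
Local Notation mu2 := (mu \x mu)%E.

Definition proj_XX (z : Z) : X * X := z.1.
Definition proj_X (z : Z) : X := z.1.1.

Lemma measurable_proj_XX : measurable_fun setT proj_XX.
Proof. exact: measurable_fst. Qed.

Lemma measurable_proj_X : measurable_fun setT proj_X.
Proof. exact: (measurableT_comp measurable_fst measurable_fst). Qed.

HB.instance Definition _ := isMeasurableFun.Build _ _ _ _
  proj_XX measurable_proj_XX.
HB.instance Definition _ := isMeasurableFun.Build _ _ _ _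
  proj_X measurable_proj_X.

(* The measures with densities p_{X,X'} and p_X are the corresponding marginals
   of P. *)
Definition P_XX (P : probability Z R) : probability (X * X)%type R :=
  distribution P proj_XX.
Definition P_X (P : probability Z R) : probability X R :=
  distribution P proj_X.

Definition p_XX (p : Z -> R) (z : X * X) : R := p (z, true) + p (z, false).
Definition p_Y (p : Z -> R) (y : bool) : R := (\int[mu2]_z p (z, y))%R.
Definition q (p : Z -> R) (z : X * X) : R := p (z, true) / p_Y p true.
Definition eta (p : Z -> R) (z : X * X) : R := p (z, true) / p_XX p z.

Definition is_density (P : probability Z R) (p : Z -> R) : Prop :=
  [/\ measurable_fun setT p, forall z, 0 <= p z &
      forall A : set Z, measurable A ->
        P A = (\int[(mu2 \x counting)%E]_(z in A) (p z)%:E)%E].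

(* pX and pX' are (versions of) the two marginals of r *)
Definition marginals (r : X * X -> R) (pX pX' : X -> R) : Prop :=
  {ae mu, forall x, (pX x)%:E = (\int[mu]_x' (r (x, x'))%:E)%E} /\
  {ae mu, forall x', (pX' x')%:E = (\int[mu]_x (r (x, x'))%:E)%E}.

Definition density_structure (P : probability Z R) (p : Z -> R) (pX pX' : X -> R) : Prop :=
  [/\ P `<< (mu2 \x counting)%E /\ is_density P p,
      marginals (p_XX p) pX pX',
      marginals (q p) pX pX',
      forall x x', p (x, x', true) = p_Y p true * q p (x, x') &
      forall x x', p (x, x', false) = p_Y p false * pX x * pX' x'].

(* s^(1/(tau-1)), read as s^(+oo) when tau = 1 *)
Definition noise_pow (tau s : R) : R :=
  if tau == 1 then (s == 1)%:R else s `^ (tau - 1)^-1.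

Definition noise_condition (tau theta : R) (P : probability Z R)
    (et : X * X -> R) : Prop :=
  let ineq (c s : R) := (P_XX P [set z | (`|2 * et z - 1| <= s)%R] <=
                   (c * noise_pow tau s)%R%:E)%E in
  (1 < tau /\
    exists2 c, 1 <= c <= theta^-1 & forall s, 0 < s <= 1 -> ineq c s) \/
  (tau = 1 /\
    exists2 s0, theta <= s0 <= 1 &
      forall s c, 0 < s <= s0 -> 1 <= c -> ineq c s).

Definition density_regularity (xi : params R) (p : Z -> R) (pX pX' : X -> R) : Prop :=
  [/\ forall x x', q p (x, x') = q p (x', x),
      ('N[mu2]_(+oo)[EFin \o q p] <= (theta1 xi ^+ 2)%:E)%E,
      [/\ continuous pX, forall x, 0 < pX x & forall x, `|pX x| <= theta1 xi],
      [/\ continuous pX', forall x, 0 < pX' x & forall x, `|pX' x| <= theta1 xi] &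
      theta2 xi <= p_Y p false < 1].

Definition cluster_structure (xi : params R) (alpha : R) (P : probability Z R)
    (p : Z -> R) (S : 'I_(sdim xi).+1 -> set X) : Prop :=
  [/\ smooth_partition (depth xi) alpha (radius xi) S,
      forall i, (P_X P (S i) <= (theta3 xi)%:E)%E &
      [set z | 1 / 2 <= eta p z] = \bigcup_i (S i `*` S i)].

(* Densities are only defined almost everywhere: the conditions are required for
   some version p of the density of P and some versions pX, pX' of its
   marginals. *)
Definition admissible (xi : params R) (alpha tau : R) (P : probability Z R)
    (S : 'I_(sdim xi).+1 -> set X) : Prop :=
  exists (p : Z -> R) (pX pX' : X -> R),
    [/\ density_structure P p pX pX',
        noise_condition tau (thetaNC xi) P (eta p),
        density_regularity xi p pX pX' &
        cluster_structure alpha P p S].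

End distributions.

Definition class_alpha_tau {R : realType} (xi : params R) (alpha tau : R) :
    set (probability (sample R (dimX xi)) R) :=
  [set P | exists S : 'I_(sdim xi).+1 -> set (cube R (dimX xi)),
             admissible alpha tau P S].

Arguments class_alpha_tau {R} xi alpha tau _.

Definition class_tau {R : realType} (xi : params R) (tau : R) :
    set (probability (sample R (dimX xi)) R) :=
  \bigcup_(alpha in [set a : R | 0 < a]) class_alpha_tau xi alpha tau.

Arguments class_tau {R} xi tau _.

Definition class_xi {R : realType} (xi : params R) :
    set (probability (sample R (dimX xi)) R) :=
  \bigcup_(tau in [set t : R | 1 <= t]) class_tau xi tau.

Arguments class_xi {R} xi _.

(* P |-> S_P selects one of the partitions witnessing that P is in the class. *)
Definition is_selection {R : realType} (xi : params R)
    (S : probability (sample R (dimX xi)) R ->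
         'I_(sdim xi).+1 -> set (cube R (dimX xi))) : Prop :=
  forall P, class_xi xi P ->
    exists alpha tau : R, [/\ 0 < alpha, 1 <= tau & admissible alpha tau P (S P)].

Section simplex.
Variables (R : realType) (d : nat).
Implicit Types v : 'I_d.+1 -> 'rV[R]_d.

(* Euclidean norm; the library's norm on 'rV[R]_d is the sup norm *)
Definition enorm (u : 'rV[R]_d) : R := Num.sqrt (\sum_j u 0 j ^+ 2).

Definition regular_simplex v : Prop :=
  [/\ forall i, enorm (v i) = 1, \sum_i v i = 0 &
      forall i j k l, i != j -> k != l ->
        enorm (v i - v j) = enorm (v k - v l)].

Definition hull v (I : {set 'I_d.+1}) : set 'rV[R]_d :=
  [set y | exists g : 'I_d.+1 -> R,
    [/\ forall i, 0 <= g i, forall i, i \notin I -> g i = 0,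
        \sum_i g i = 1 & y = \sum_i g i *: v i]].

Definition simplex v : set 'rV[R]_d := hull v [set: 'I_d.+1]%SET.

Definition diam v : R :=
  sup [set r | exists x y, [/\ simplex v x, simplex v y & r = enorm (x - y)]].

Definition Dproj v : R :=
  inf [set enorm (v ord0 - y) | y in hull v [set~ ord0]%SET].

End simplex.

Section estimators.
Variables (R : realType) (K d : nat).
Local Notation X := (cube R K).
Local Notation Z := (sample R K).
Implicit Types (v : 'I_d.+1 -> 'rV[R]_d) (g : 'I_d.+1 -> X -> R)
  (f : X -> 'rV[R]_d) (S : 'I_d.+1 -> set X).

Definition G0 : set ('I_d.+1 -> X -> R) :=
  [set g : 'I_d.+1 -> X -> R | [/\ forall i, measurable_fun setT (g i),
    forall i x, 0 <= g i x <= 1 &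
    forall x, \sum_i g i x = 1]].

Definition combine v g : X -> 'rV[R]_d := fun x => \sum_i g i x *: v i.

Definition F0 v : set (X -> 'rV[R]_d) :=
  [set f : X -> 'rV[R]_d | exists2 g, G0 g & f = combine v g].

Definition fstar v S : X -> 'rV[R]_d := combine v (fun i => \1_(S i)).

Definition localized v (beta beta0 : R) (P : probability Z R) S
    (F : set (X -> 'rV[R]_d)) : set (X -> 'rV[R]_d) :=
  [set f : X -> 'rV[R]_d | F f /\
    ((1 - beta0)%:E <= P_X P [set x | (enorm (f x - fstar v S x) < beta)%R])%E].

Definition rho f (z : X * X) : R := enorm (f z.1 - f z.2) ^+ 2.

Definition psi v (s : R) : R := 1 - 2 * (diam v) ^- 2 * s.

Definition loss v f (z : Z) : R :=
  Num.max 0 (1 - label z.2 * psi v (rho f z.1)).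

Definition excess v S f (P : probability Z R) : \bar R :=
  ('E_P[loss v f] - 'E_P[loss v (fstar v S)])%E.

Definition sq_error S g (P : probability Z R) : \bar R :=
  (\sum_i 'N[P_X P]_(2%:E)[(fun x => (g i x - \1_(S i) x)%R%:E)] ^+ 2)%E.

End estimators.

Section iid.
Context d d' (Omega : measurableType d) (T : measurableType d') (R : realType).
Variables (Pr : probability Omega R) (n : nat) (U : 'I_n -> {RV Pr >-> T}).

(* For a finite family, the product rule for all (A_i) contains the one for every
   subfamily (take A_i = setT). *)
Definition independent : Prop :=
  forall A : 'I_n -> set T, (forall i, measurable (A i)) ->
    Pr (\bigcap_(i in [set: 'I_n]) (U i @^-1` A i)) =
    (\prod_i Pr (U i @^-1` A i))%E.

Definition iid (P : probability T R) : Prop :=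
  independent /\
  forall i A, measurable A -> distribution Pr (U i) A = P A.

Definition joint (w : Omega) : n.-tuple T := [tuple U i w | i < n].

End iid.

Section risk.
Context d (Omega : measurableType d) (R : realType).
Variables (K m n : nat) (Pr : probability Omega R).
Variable U : 'I_n -> {RV Pr >-> sample R K}.

Definition risk (S : 'I_m.+1 -> set (cube R K))
    (ghat : n.-tuple (sample R K) -> 'I_m.+1 -> cube R K -> R)
    (P : probability (sample R K) R) : \bar R :=
  (\int[Pr]_w sq_error S (ghat (joint U w)) P)%E.

Definition expected_excess (v : 'I_m.+1 -> 'rV[R]_m)
    (S : 'I_m.+1 -> set (cube R K))
    (fhat : n.-tuple (sample R K) -> cube R K -> 'rV[R]_m)
    (P : probability (sample R K) R) : \bar R :=
  (\int[Pr]_w excess v S (fhat (joint U w)) P)%E.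

End risk.

(* Main.v *)
From HB Require Import structures.
Require Import Defs.
From mathcomp Require Import all_boot all_order all_algebra.
From mathcomp Require Import all_classical all_reals all_analysis.
From mathcomp Require Import perm.
From mathcomp Require Import measurable_realfun.
From mathcomp Require Import ring lra.
Import Order.TTheory GRing.Theory Num.Theory.
Import numFieldNormedType.Exports.

Local Open Scope classical_set_scope.
Local Open Scope ring_scope.

(** Write a map with values in the simplex in barycentric coordinates,
    [f = \sum_i g_i v_i], let [c x] be the index of the cluster of [x], and put
    [N (x, x') = \sum_i (g_i x - g_i x')^2], which lies in [[0, 2]].  Since the
    [v_i] are unit vectors at equal mutual distances, the normalization of [psi]
    turns [psi (rho_f)] into [1 - N].  The positive part in the hinge loss is
    therefore inactive, and the loss is [N] on the label 1 and [2 - N] on the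
    label -1: it is affine in [N].

    For [f*] the same quantity is [N* = 2 * 1(c x <> c x')], and the clusters
    tell where the label 1 is at least as likely as the label -1.  Hence the
    integrand of the excess risk is [|2 eta - 1| |N - N*|], up to the density of
    the pair, and discarding the pairs with [|2 eta - 1| <= s] gives, for every
    level [s] (lemma [excess_lower_bound]),
    [s * \int |N - N*| dP_XX <= excess + 2 s * P_XX (|2 eta - 1| <= s)].

    The integral on the left controls the squared error (lemma
    [separation_bound]).  If [x] and [x'] lie in different clusters then
    [|N - N*| = 2 - N], which is at least the impurity [1 - \sum_i g_i(x)^2] of
    the coordinates of [x] alone.  If moreover [f x] is closer than
    [beta < D_proj] to the vertex [v_(c x)], then the coordinate [g_(c x) x] is
    at least [1 - beta / D_proj > 0] (lemma [near_vertex_weight]), and the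
    impurity dominates [\sum_i (g_i x - 1_(K_i) x)^2] up to a constant.
    Whatever the value of [x], enough mass of [x'] lies in other clusters: the
    part of the density carried by the label -1 is [p_Y(-1) p_X p_X'], with
    [p_Y(-1) >= theta_2], and no cluster has mass above [theta_3].  The points
    where [f] is far from [f*] have mass at most [beta_0], and the error there
    is at most 2.

    Together (lemma [sq_error_bound]) the squared error is at most
    [excess / (k s) + (2 / k) P_XX (|2 eta - 1| <= s) + 2 beta_0] with a constant
    [k] depending on [xi], [v] and [beta] only.  This is affine in the excess,
    so it can be integrated over the sample with [s] still free; choosing [s]
    afterwards, as a power of the expected excess, yields the exponent
    [1 / tau] with no convexity argument.  As [log n >= log 2], a suitable
    multiple of [log n] exceeds any given constant.  When the expected
    excess vanishes there is no best level [s], and one is chosen that leaves a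
    term in [1 / n].

    The noise condition and the partition may come with different versions of
    the density; these agree almost everywhere (lemma [density_unique]), so
    that the noise condition passes from one to the other. *)

(** * Integration against a density on labelled pairs *)

Section integral_on_labelled_space.
Local Open Scope ereal_scope.
Context {R : realType}.

(** A copy of the counting measure under a name of its own, to which finiteness
    can be attached: Fubini's theorem asks for it. *)
Definition counting_bool : set bool -> \bar R := @counting bool R.

HB.instance Definition _ := Measure.on counting_bool.

Lemma counting_bool_fin : fin_num_fun counting_bool.
Proof.
move=> A _; rewrite /counting_bool /counting asboolT//.
exact: finite_finset.
Qed.

HB.instance Definition _ :=
  Measure_isFinite.Build _ _ _ counting_bool counting_bool_fin.

Lemma counting_boolE (A : set bool) : counting_bool A = \d_true A + \d_false A.
Proof.
have counting1 b : counting_bool (A `&` [set b]) = \d_b A.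
  rewrite diracE; case: (boolP (b \in A)) => [|/negP] bA.
    rewrite (_ : A `&` _ = [set b]); last first.
      by apply/setIidPr => _ ->; rewrite -in_setE.
    by rewrite /counting_bool /counting asboolT// fset_set1 finmap.cardfs1.
  rewrite (_ : A `&` _ = set0) ?measure0//.
  by apply/seteqP; split => // c [Ac cb]; apply: bA; rewrite inE -cb.
rewrite -!counting1 -measureU//.
  rewrite -setIUr (_ : _ `|` _ = setT) ?setIT//.
  by apply/seteqP; split => -[]//; [left|right].
by apply/seteqP; split => // -[] [] [_ ? [_]].
Qed.

Lemma integral_counting_bool (f : bool -> \bar R) : (forall b, 0 <= f b) ->
  \int[counting_bool]_b f b = f true + f false.
Proof.
move=> f0; rewrite (@eq_measure_integral _ _ _ _ (measure_add \d_true \d_false)).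
  rewrite ge0_integral_measure_add// !integral_dirac//.
  by rewrite !diracT !mul1e.
move=> A mA _; exact: etrans (counting_boolE A) (esym (measure_addE _ _ _)).
Qed.

Context {d} {T : measurableType d}.

Lemma integral_prod_bool (m : probability T R)
    (G : T * bool -> \bar R) : measurable_fun setT G -> (forall w, 0 <= G w) ->
  \int[m \x counting_bool]_w G w = \int[m]_z (G (z, true) + G (z, false)).
Proof.
move=> mG G0.
rewrite fubini_tonelli1//.
by apply: eq_integral => z _; rewrite /fubini_F integral_counting_bool.
Qed.

End integral_on_labelled_space.

Section density.
Local Open Scope ereal_scope.
Context {d} {T : measurableType d} {R : realType}.

(** Both [p] and the Radon-Nikodym derivative of [nu] integrate to [nu] over all
    measurable sets, hence they agree almost everywhere; the change of variables
    known for the latter then holds for [p]. *)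
Lemma integral_density (nu : {finite_measure set T -> \bar R})
    (m : {sigma_finite_measure set T -> \bar R}) (p : T -> R) :
  nu `<< m -> measurable_fun setT p -> (forall x, 0 <= p x)%R ->
  (forall A, measurable A -> nu A = \int[m]_(x in A) (p x)%:E) ->
  forall F : T -> \bar R, measurable_fun setT F -> (forall x, 0 <= F x) ->
  \int[nu]_x F x = \int[m]_x (F x * (p x)%:E).
Proof.
move=> num mp p0 nup F mF F0.
have mp' : measurable_fun setT (EFin \o p) by exact/measurable_EFinP.
rewrite -(Radon_Nikodym_SigmaFinite.change_of_variables num F0 measurableT mF).
have mRN := measurable_int _ (Radon_Nikodym_SigmaFinite.f_integrable num).
apply: ge0_ae_eq_integral => //.
- exact: emeasurable_funM.
- exact: emeasurable_funM.
- by move=> x _; rewrite mule_ge0// Radon_Nikodym_SigmaFinite.f_ge0.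
- by move=> x _; rewrite mule_ge0// lee_fin.
have : ae_eq m setT (Radon_Nikodym_SigmaFinite.f nu m) (EFin \o p).
  apply: integral_ae_eq => //.
    exact: Radon_Nikodym_SigmaFinite.f_integrable.
  by move=> E _ mE; rewrite -Radon_Nikodym_SigmaFinite.f_integral// nup.
by apply: filterS => x /= + _ => ->.
Qed.

End density.

Section sample_density.
Context {R : realType} {K : nat}.
Local Notation X := (cube R K).
Local Notation mu := (@lebesgue_cube R K).
Local Notation mu2 := (mu \x mu)%E.

Definition labelled_lebesgue := (mu2 \x @counting_bool R)%E.

HB.instance Definition _ := Measure.on labelled_lebesgue.

Lemma labelled_lebesgue_fin : fin_num_fun labelled_lebesgue.
Proof.
move=> A mA; rewrite ge0_fin_numE//.
apply: (@le_lt_trans _ _ (labelled_lebesgue setT)).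
  by apply: le_measure; rewrite ?inE.
rewrite /labelled_lebesgue -setXTT product_measure1E//= counting_boolE !diracT.
by rewrite [X in (X * _)%E]probability_setT mul1e ltry.
Qed.

HB.instance Definition _ := Measure_isFinite.Build _ _ _ labelled_lebesgue
  labelled_lebesgue_fin.

Lemma measurable_slice (F : sample R K -> R) b :
  measurable_fun setT F -> measurable_fun setT (fun z => F (z, b)).
Proof. by move=> mF; exact: measurableT_comp mF (pair2_measurable b). Qed.

Lemma measurable_p_XX (p : sample R K -> R) : measurable_fun setT p ->
  measurable_fun setT (p_XX p).
Proof. by move=> mp; apply: measurable_funD; exact: measurable_slice. Qed.

Variables (P : probability (sample R K) R) (p : sample R K -> R).
Hypotheses (Pmu : P `<< (mu2 \x counting)%E) (Pp : is_density P p).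

Lemma integral_sample (F : sample R K -> R) :
  measurable_fun setT F -> (forall w, 0 <= F w) ->
  (\int[P]_w (F w)%:E =
   \int[mu2]_z (F (z, true) * p (z, true) + F (z, false) * p (z, false))%:E)%E.
Proof.
move=> mF F0; have [mp p0 PE] := Pp.
rewrite (@integral_density _ _ _ _ labelled_lebesgue p)//; last exact/measurable_EFinP.
have mFp : measurable_fun setT (fun w => (F w * p w)%:E).
  exact/measurable_EFinP/measurable_funM.
have Fp0 w : (0 <= (F w * p w)%:E)%E by rewrite lee_fin mulr_ge0.
have := integral_prod_bool mu2 _ mFp Fp0.
exact.
Qed.

Lemma integral_P_XX (h : X * X -> R) :
  measurable_fun setT h -> (forall z, 0 <= h z) ->
  (\int[P_XX P]_z (h z)%:E = \int[mu2]_z (h z * p_XX p z)%:E)%E.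
Proof.
move=> mh h0; rewrite ge0_integral_distribution//; last exact/measurable_EFinP.
rewrite (integral_sample (fun w => h w.1))//.
  by apply: eq_integral => z _; rewrite /p_XX mulrDr.
exact: measurableT_comp mh measurable_fst.
Qed.

(** Tonelli's theorem integrates the second coordinate out of the pair density,
    which leaves [pX] almost everywhere. *)
Lemma integral_P_X (w pX pX' : X -> R) :
  marginals (p_XX p) pX pX' -> measurable_fun setT pX -> (forall x, 0 <= pX x) ->
  measurable_fun setT w -> (forall x, 0 <= w x) ->
  (\int[P_X P]_x (w x)%:E = \int[mu]_x (w x * pX x)%:E)%E.
Proof.
move=> [mar _] mpX pX0 mw w0; have [mp p0 PE] := Pp.
rewrite ge0_integral_distribution//; last exact/measurable_EFinP.
rewrite (integral_sample (fun u => w u.1.1))//; last first.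
  by have := measurableT_comp mw (@measurable_proj_X R K); exact.
under eq_integral do rewrite -mulrDr.
have mwp : measurable_fun setT (fun z => (w z.1 * p_XX p z)%:E).
  apply/measurable_EFinP/measurable_funM; last exact: measurable_p_XX.
  exact: measurableT_comp mw measurable_fst.
have wp0 z : (0 <= (w z.1 * p_XX p z)%:E)%E by rewrite lee_fin mulr_ge0// addr_ge0.
rewrite [LHS](fubini_tonelli1 (fun z => (w z.1 * p_XX p z)%:E))//.
apply: ge0_ae_eq_integral => //.
- exact: measurable_fun_fubini_tonelli_F.
- exact/measurable_EFinP/measurable_funM.
- by move=> x _; apply: integral_ge0.
- by move=> x _; rewrite lee_fin mulr_ge0.
apply: filterS mar => x /= marx _.
transitivity (\int[mu]_y ((w x)%:E * (p_XX p (x, y))%:E))%E => //.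
rewrite [RHS]EFinM marx ge0_integralZl ?lee_fin//.
  apply/measurable_EFinP.
  by have := measurableT_comp (measurable_p_XX p mp) (pair1_measurable x); exact.
by move=> y _; rewrite lee_fin addr_ge0.
Qed.

Lemma P_XXE (A : set (X * X)) : measurable A ->
  (P_XX P A = \int[mu2]_(z in A) (p_XX p z)%:E)%E.
Proof.
move=> mA; transitivity (\int[P_XX P]_z (\1_A z)%:E)%E.
  by rewrite integral_indic// setIT.
rewrite integral_P_XX//.
rewrite [RHS]integral_mkcond; apply: eq_integral => z _.
by rewrite patchE indicE; case: (z \in A); rewrite ?mul1r ?mul0r.
Qed.

End sample_density.

Section versions.
Context {R : realType} {K : nat}.
Local Notation X := (cube R K).
Local Notation mu := (@lebesgue_cube R K).
Local Notation mu2 := (mu \x mu)%E.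
Variables (P : probability (sample R K) R) (p p' : sample R K -> R).
Hypotheses (Pmu : P `<< (mu2 \x counting)%E).
Hypotheses (Pp : is_density P p) (Pp' : is_density P p').

Lemma density_slice_unique b :
  ae_eq mu2 setT (fun z => (p (z, b))%:E) (fun z => (p' (z, b))%:E).
Proof.
have [mp p0 _] := Pp; have [mp' p'0 _] := Pp'.
have slice (r : sample R K -> R) E : is_density P r -> measurable E ->
    (\int[mu2]_(z in E) (r (z, b))%:E = P (E `*` [set b]))%E.
  move=> Pr mE; have [mr r0 _] := Pr.
  have mEb : measurable (E `*` [set b]) by exact: measurableX.
  transitivity (\int[P]_w (\1_(E `*` [set b]) w)%:E)%E; last first.
    by rewrite integral_indic// setIT.
  rewrite (integral_sample _ _ Pmu Pr)//.
  rewrite integral_mkcond; apply: eq_integral => z _.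
  have inEb c : ((z, c) \in E `*` [set b]) = (z \in E) && (c == b).
    apply/idP/andP; rewrite !inE/=; first by move=> [? ->].
    by move=> [? /eqP].
  rewrite patchE !indicE !inEb.
  by case: (z \in E); case: b {mEb inEb} => /=; rewrite ?mul1r ?mul0r ?addr0 ?add0r.
apply: integral_ae_eq => //.
- apply/integrableP; split; first by apply/measurable_EFinP; exact: measurable_slice.
  rewrite (eq_integral (fun z => (p (z, b))%:E)); last first.
    by move=> z _; rewrite gee0_abs// lee_fin.
  by rewrite slice// -ge0_fin_numE// fin_num_measure//; exact: measurableX.
- by apply/measurable_EFinP; exact: measurable_slice.
- by move=> E _ mE; rewrite !slice.
Qed.

Lemma density_unique : {ae mu2, forall z,
  p (z, true) = p' (z, true) /\ p (z, false) = p' (z, false)}.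
Proof.
have := density_slice_unique true; have := density_slice_unique false.
by apply: filterS2 => z /(_ I)[->] /(_ I)[->].
Qed.

End versions.

(** Low-noise sets are handled in this division-free form, for which
    measurability is immediate; [noise_setE] relates it to [eta]. *)
Lemma measurable_noise_set {R : realType} {K : nat} (p : sample R K -> R) (s : R) :
  measurable_fun setT p ->
  measurable [set z | `|p (z, true) - p (z, false)| <= s * p_XX p z].
Proof.
move=> mp; rewrite -[X in measurable X]setTI.
apply: (measurable_fun_le (f := fun z => `|p (z, true) - p (z, false)|)
  (g := fun z => s * p_XX p z)) => //.
  apply: measurableT_comp => //; apply: measurable_funB; exact: measurable_slice.
apply: measurable_funM => //; exact: measurable_p_XX.
Qed.

Lemma noise_setE {R : realType} {K : nat} (p : sample R K -> R) (s : R) :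
  (forall z, 0 <= p (z, true)) -> (forall z, 0 < p (z, false)) ->
  [set z | `|2 * eta p z - 1| <= s] =
  [set z | `|p (z, true) - p (z, false)| <= s * p_XX p z].
Proof.
move=> p1 p2; apply: eq_set => z; apply/propext.
have q0 : 0 < p_XX p z by rewrite ltr_wpDl.
have -> : 2 * eta p z - 1 = (p (z, true) - p (z, false)) / p_XX p z.
  by move: q0; rewrite /eta /p_XX => q0; field; rewrite gt_eqF.
by rewrite normrM normfV (gtr0_norm q0) ler_pdivrMr.
Qed.

Lemma noise_mass_version {R : realType} {K : nat} (P : probability (sample R K) R)
    (p p' : sample R K -> R) (s : R) :
  P `<< (lebesgue_cube R K \x lebesgue_cube R K \x counting)%E ->
  is_density P p -> is_density P p' ->
  (forall z, 0 < p (z, false)) -> (forall z, 0 < p' (z, false)) ->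
  P_XX P [set z | `|2 * eta p z - 1| <= s] =
  P_XX P [set z | `|2 * eta p' z - 1| <= s].
Proof.
move=> Pmu Pp Pp' p2 p2'; have [mp p0 _] := Pp; have [mp' p0' _] := Pp'.
rewrite !noise_setE// (P_XXE _ _ Pmu Pp) ?(P_XXE _ _ Pmu Pp');
  try exact: measurable_noise_set.
rewrite integral_mkcond [RHS]integral_mkcond.
apply: ge0_ae_eq_integral => //.
- apply/(measurable_restrictT _ _).1; first exact: measurable_noise_set.
  by apply/measurable_funTS/measurable_EFinP; exact: measurable_p_XX.
- apply/(measurable_restrictT _ _).1; first exact: measurable_noise_set.
  by apply/measurable_funTS/measurable_EFinP; exact: measurable_p_XX.
- by move=> z _; apply: erestrict_ge0 => ? _; rewrite lee_fin addr_ge0.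
- by move=> z _; apply: erestrict_ge0 => ? _; rewrite lee_fin addr_ge0.
have := density_unique _ _ _ Pmu Pp Pp'.
apply: filterS => z [e1 e2] _; rewrite !patchE.
congr (if _ then _ else _); last by rewrite /p_XX e1 e2.
by apply/idP/idP; rewrite !inE/= /p_XX e1 e2.
Qed.

(** * Barycentric coordinates in a regular simplex *)

Section probability_vectors.
Context {R : realType} {d : nat}.
Implicit Types a b : 'I_d.+1 -> R.

Definition prob_vector a := (forall i, 0 <= a i) /\ \sum_i a i = 1.

Definition vertex (i : 'I_d.+1) : 'I_d.+1 -> R := fun k => (k == i)%:R.

Definition sqdist a b : R := \sum_i (a i - b i) ^+ 2.

Lemma vertex_prob i : prob_vector (vertex i).
Proof.
split=> [k|]; first by rewrite ler0n.
by rewrite /vertex (bigD1 i)//= eqxx big1 ?addr0// => k /negPf ->.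
Qed.

Lemma prob_vector_le1 a i : prob_vector a -> a i <= 1.
Proof. by move=> [a0 <-]; rewrite (bigD1 i)//= lerDl sumr_ge0. Qed.

Lemma sqdist_ge0 a b : 0 <= sqdist a b.
Proof. by apply: sumr_ge0 => i _; rewrite sqr_ge0. Qed.

Lemma sum_sqr_le1 a : prob_vector a -> \sum_i a i ^+ 2 <= 1.
Proof.
move=> pa; have [a0 <-] := pa; apply: ler_sum => i _.
by rewrite expr2 ler_piMl// prob_vector_le1.
Qed.

Lemma sqdist_le2 a b : prob_vector a -> prob_vector b -> sqdist a b <= 2.
Proof.
move=> pa pb; apply: (@le_trans _ _ (\sum_i (a i ^+ 2 + b i ^+ 2))).
  apply: ler_sum => i _; rewrite sqrrB -subr_ge0.
  rewrite (_ : _ - _ = (a i * b i) *+ 2); last by ring.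
  by rewrite mulrn_wge0// mulr_ge0//; [case: pa|case: pb].
by rewrite big_split/= [leRHS](_ : 2 = 1 + 1)// lerD// sum_sqr_le1.
Qed.

Lemma sqdist_vertex i j : sqdist (vertex i) (vertex j) = 2 * (i != j)%:R.
Proof.
rewrite /sqdist; have [->|ij] := eqVneq i j.
  by rewrite mulr0 big1// => k _; rewrite subrr expr0n.
rewrite (bigD1 i)//= (bigD1 j) 1?eq_sym//= /vertex !eqxx.
rewrite (negPf ij) eq_sym (negPf ij) big1 => [|k /andP[/negPf -> /negPf ->]].
  by rewrite subr0 sub0r sqrrN !expr1n addr0 mulr1.
by rewrite subrr expr0n.
Qed.

(** The coordinates other than [i] sum to [1 - a i], so that the sum of their
    squares is at most [1 - a i] as well. *)
Lemma sqdist_to_vertex a i : prob_vector a -> sqdist a (vertex i) <= 2 * (1 - a i).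
Proof.
move=> pa; have [a0 a1] := pa; rewrite /sqdist (bigD1 i)//= /vertex eqxx.
have ai : 1 - a i = \sum_(k | k != i) a k.
  by rewrite -a1 (bigD1 i)//= addrAC subrr add0r.
rewrite mulr_natl mulr2n lerD//.
  rewrite -sqrrN opprB expr2 ler_piMl ?subr_ge0 ?prob_vector_le1//.
  by rewrite lerBlDr lerDl.
rewrite ai; apply: ler_sum => k /negPf ->; rewrite subr0 expr2 ler_piMl//.
exact: prob_vector_le1.
Qed.

(** Expanding the square, [2 - sqdist a b] is the sum of the impurities
    [1 - \sum a^2] and [1 - \sum b^2] and of twice the scalar product of [a] and
    [b]; all three are nonnegative and the first is at least
    [a i * (1 - a i)].  In this way a statement on a pair of points yields one on
    a single point. *)
Lemma separation_deficit a b i (kappa : R) : prob_vector a -> prob_vector b ->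
  kappa <= a i -> kappa / 2 * sqdist a (vertex i) <= 2 - sqdist a b.
Proof.
move=> pa pb ka; have [a0 a1] := pa; have [b0 _] := pb.
have ai1 : 0 <= 1 - a i by rewrite subr_ge0 prob_vector_le1.
apply: (@le_trans _ _ (a i * (1 - a i))).
  apply: (@le_trans _ _ (a i / 2 * sqdist a (vertex i))).
    by rewrite ler_wpM2r ?sqdist_ge0// ler_wpM2r// invr_ge0.
  rewrite -mulrA ler_wpM2l// mulrC ler_pdivrMr//.
  by rewrite mulrC; exact: sqdist_to_vertex.
apply: (@le_trans _ _ (1 - \sum_k a k ^+ 2)).
  rewrite -{2}a1 -sumrB (bigD1 i)//= expr2 mulrBr mulr1 lerDl.
  by apply: sumr_ge0 => k _; rewrite subr_ge0 expr2 ler_piMl// prob_vector_le1.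
have -> : sqdist a b = \sum_k a k ^+ 2 + \sum_k b k ^+ 2 - 2 * \sum_k (a k * b k).
  rewrite /sqdist mulr_sumr -big_split -sumrB/=.
  by apply: eq_bigr => k _; ring.
have := sum_sqr_le1 _ pb.
have : 0 <= \sum_k (a k * b k) by apply: sumr_ge0 => k _; rewrite mulr_ge0.
by lra.
Qed.

End probability_vectors.

Section regular_simplex_geometry.
Context {R : realType} {d : nat}.
Variable v : 'I_d.+1 -> 'rV[R]_d.

Lemma enorm_ge0 (u : 'rV[R]_d) : 0 <= enorm u.
Proof. exact: sqrtr_ge0. Qed.

Lemma enorm_sqr (u : 'rV[R]_d) : enorm u ^+ 2 = \sum_j u 0 j ^+ 2.
Proof. by rewrite sqr_sqrtr// sumr_ge0// => j _; exact: sqr_ge0. Qed.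

Lemma enorm_sqr_combination (c : 'I_d.+1 -> R) :
  enorm (\sum_i c i *: v i) ^+ 2 =
  \sum_i \sum_k c i * c k * (\sum_j v i 0 j * v k 0 j).
Proof.
rewrite enorm_sqr.
under eq_bigr => j _.
  rewrite summxE expr2 big_distrlr/=.
  under eq_bigr do under eq_bigr do rewrite !mxE mulrACA.
  over.
rewrite exchange_big/=; apply: eq_bigr => i _.
rewrite exchange_big/=; apply: eq_bigr => k _.
by rewrite mulr_sumr.
Qed.

Hypotheses (rv : regular_simplex v) (d0 : (0 < d)%N).

Let i1 : 'I_d.+1 := ord_max.
(** Any two vertices would do: all the distances agree. *)
Definition side := enorm (v ord0 - v i1).

Lemma i1_neq0 : ord0 != i1.
Proof. by rewrite -val_eqE/= neq_ltn d0. Qed.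

Lemma simplex_dot i k : \sum_j v i 0 j * v k 0 j =
  1 - side ^+ 2 / 2 + (i == k)%:R * (side ^+ 2 / 2).
Proof.
have [v1 _ vd] := rv.
have v1' l : \sum_j v l 0 j ^+ 2 = 1 by rewrite -enorm_sqr v1 expr1n.
have [->|ik] := eqVneq i k.
  by rewrite mul1r subrK; under eq_bigr do rewrite -expr2.
have : enorm (v i - v k) ^+ 2 = side ^+ 2 by rewrite (vd _ _ _ _ ik i1_neq0).
rewrite enorm_sqr.
have -> : \sum_j (v i - v k) 0 j ^+ 2 = \sum_j v i 0 j ^+ 2 + \sum_j v k 0 j ^+ 2
   - 2 * \sum_j v i 0 j * v k 0 j.
  rewrite mulr_sumr -big_split -sumrB/=; apply: eq_bigr => j _.
  by rewrite !mxE; ring.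
by rewrite !v1' mul0r; lra.
Qed.

(** The Gram matrix of the vertices is constant off the diagonal and constant on
    it, hence a combination of the all-ones matrix and of the identity. *)
Lemma enorm_sqr_simplex (c : 'I_d.+1 -> R) :
  enorm (\sum_i c i *: v i) ^+ 2 =
  (1 - side ^+ 2 / 2) * (\sum_i c i) ^+ 2 + side ^+ 2 / 2 * \sum_i c i ^+ 2.
Proof.
rewrite enorm_sqr_combination.
under eq_bigr do under eq_bigr do rewrite simplex_dot mulrDr.
under eq_bigr do rewrite big_split/= -mulr_suml -mulr_sumr.
rewrite big_split/= -mulr_suml -mulr_suml -expr2 mulrC; congr (_ + _).
rewrite mulr_sumr; apply: eq_bigr => i _.
rewrite (bigD1 i)//= eqxx big1 ?addr0; first by rewrite mul1r mulrC expr2.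
by move=> k; rewrite eq_sym => /negPf ->; rewrite mul0r mulr0.
Qed.

(** If all the vertices coincided, their sum would be a nonzero multiple of one
    unit vector; but it is zero. *)
Lemma side_gt0 : 0 < side.
Proof.
rewrite lt_neqAle enorm_ge0 andbT eq_sym; apply/eqP => s0.
have := enorm_sqr_simplex (fun=> 1).
have [_ v0 _] := rv.
under eq_bigr do rewrite scale1r.
rewrite v0 enorm_sqr big1 => [|j _]; last by rewrite mxE expr0n.
rewrite s0 expr0n/= mul0r subr0 mul0r mul1r addr0 sumr_const card_ord.
by move=> /eqP; rewrite eq_sym expf_eq0/= pnatr_eq0.
Qed.

Lemma enorm_sqr_barycentric (a b : 'I_d.+1 -> R) : \sum_i a i = \sum_i b i ->
  enorm (\sum_i a i *: v i - \sum_i b i *: v i) ^+ 2 = side ^+ 2 / 2 * sqdist a b.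
Proof.
move=> ab; have -> : \sum_i a i *: v i - \sum_i b i *: v i = \sum_i (a i - b i) *: v i.
  by rewrite -sumrB; apply: eq_bigr => i _; rewrite scalerBl.
by rewrite enorm_sqr_simplex sumrB ab subrr expr0n/= mulr0 add0r.
Qed.

Lemma vertexE i : v i = \sum_k vertex i k *: v k.
Proof.
rewrite (bigD1 i)//= /vertex eqxx scale1r big1 ?addr0// => k /negPf ->.
by rewrite scale0r.
Qed.

Lemma diam_side : diam v = side.
Proof.
have ub : ubound [set r | exists x y,
    [/\ simplex v x, simplex v y & r = enorm (x - y)]] side.
  move=> _ [_ [_ [[a [a0 _ a1 ->]] [b [b0 _ b1 ->]] ->]]].
  rewrite -(@ler_pXn2r _ 2) ?nnegrE ?enorm_ge0//.
  rewrite enorm_sqr_barycentric ?a1 ?b1// -mulrA ler_piMr ?sqr_ge0//.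
  by rewrite mulrC ler_pdivrMr// mul1r sqdist_le2.
have mem i : simplex v (v i).
  exists (vertex i); have [? ?] := @vertex_prob R d i; split => // [k|].
    by rewrite inE.
  exact: vertexE.
apply/eqP; rewrite eq_le; apply/andP; split.
  by apply: ge_sup ub; exists side, (v ord0), (v i1).
by apply: ub_le_sup; [exists side|exists (v ord0), (v i1)].
Qed.

Lemma psi_barycentric (a b : 'I_d.+1 -> R) : \sum_i a i = \sum_i b i ->
  psi v (enorm (\sum_i a i *: v i - \sum_i b i *: v i) ^+ 2) = 1 - sqdist a b.
Proof.
move=> ab; rewrite /psi enorm_sqr_barycentric// diam_side.
by field; rewrite gt_eqF// side_gt0.
Qed.

(** [Dproj] is defined from the first vertex; by [enorm_sqr_barycentric],
    exchanging two coordinates preserves distances, which gives the same bound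
    at the other vertices. *)
Lemma Dproj_le (a : 'I_d.+1 -> R) i : prob_vector a -> a i = 0 ->
  Dproj v <= enorm (v i - \sum_k a k *: v k).
Proof.
move=> [a0 a1] ai; pose b k := a (tperm ord0 i k).
have b1 : \sum_k b k = 1.
  by rewrite -a1 [RHS](reindex_inj (@perm_inj _ (tperm ord0 i))).
have -> : enorm (v i - \sum_k a k *: v k) = enorm (v ord0 - \sum_k b k *: v k).
  apply/eqP; rewrite -(@eqrXn2 _ 2) ?enorm_ge0//; apply/eqP.
  rewrite {1}(vertexE i) {1}(vertexE ord0).
  rewrite !enorm_sqr_barycentric ?b1 ?a1 ?(vertex_prob _).2//.
  congr (_ * _); rewrite /sqdist [LHS](reindex_inj (@perm_inj _ (tperm ord0 i))).
  apply: eq_bigr => k _; rewrite /b /vertex; congr ((_%:R - _) ^+ 2).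
  by rewrite -{2}(tpermL ord0 i) (inj_eq perm_inj).
apply: ge_inf; first by exists 0 => _ [y _ <-]; exact: enorm_ge0.
exists (\sum_k b k *: v k) => //; exists b; split=> // [k|k]; first exact: a0.
by rewrite !inE negbK => /eqP ->; rewrite /b tpermL.
Qed.

(** The point with coordinates [a] divides the segment from [v i] to the point
    of the opposite face with coordinates [a k / (1 - a i)], so that its distance
    to [v i] is [1 - a i] times the length of that segment, which is at least
    [Dproj v]. *)
Lemma near_vertex_weight (a : 'I_d.+1 -> R) i (beta : R) : 0 < beta < Dproj v ->
  prob_vector a ->
  enorm (\sum_k a k *: v k - v i) < beta -> 1 - beta / Dproj v <= a i.
Proof.
move=> /andP[beta0 betaD] pa near; have [a0 a1] := pa.
have D0 : 0 < Dproj v := lt_trans beta0 betaD.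
have [ai1|ai1] := eqVneq (a i) 1.
  by rewrite ai1 gerBl divr_ge0// ltW.
have t0 : 0 < 1 - a i by rewrite subr_gt0 lt_neqAle ai1 prob_vector_le1.
rewrite lerBlDr -lerBlDl ler_pdivlMr//.
pose b k := if k == i then 0 else a k / (1 - a i).
have pb : prob_vector b.
  split=> [k|]; first by rewrite /b; case: ifP => // _; rewrite divr_ge0// ltW.
  rewrite (bigD1 i)//= {1}/b eqxx add0r.
  under eq_bigr => k /negPf ki do rewrite /b ki.
  rewrite -mulr_suml; apply/eqP; rewrite -subr_eq0; apply/eqP.
  have <- : 1 - a i = \sum_(k | k != i) a k.
    by rewrite -a1 (bigD1 i)//= addrAC subrr add0r.
  by rewrite divff ?subrr// gt_eqF.
apply: le_trans (ltW near).
have -> : enorm (\sum_k a k *: v k - v i) = (1 - a i) * enorm (v i - \sum_k b k *: v k).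
  apply/eqP; rewrite -(@eqrXn2 _ 2) ?mulr_ge0 ?enorm_ge0 ?(ltW t0)//; apply/eqP.
  rewrite exprMn (vertexE i) !enorm_sqr_barycentric ?a1 ?pb.2 ?(vertex_prob _).2//.
  rewrite mulrCA; congr (_ * _); rewrite /sqdist mulr_sumr; apply: eq_bigr => k _.
  rewrite -exprMn /b /vertex; case: eqVneq => [->|_].
    by rewrite subr0 mulr1 -sqrrN opprB.
  by rewrite sub0r subr0 mulrN sqrrN mulrCA divff ?mulr1// gt_eqF.
by rewrite ler_pM2l// Dproj_le// /b eqxx.
Qed.

End regular_simplex_geometry.

(** * The loss in barycentric coordinates *)

Section barycentric_loss.
Context {R : realType} {K d : nat}.
Local Notation X := (cube R K).
Implicit Types g : 'I_d.+1 -> X -> R.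

Definition pair_sqdist (g : 'I_d.+1 -> X -> R) (z : X * X) : R :=
  sqdist (g ^~ z.1) (g ^~ z.2).

Lemma G0_prob g x : G0 g -> prob_vector (g ^~ x).
Proof. by move=> [_ g01 g1]; split => [i|//]; case/andP: (g01 i x). Qed.

Lemma measurable_sqdist {dO} {O : measurableType dO} (a b : 'I_d.+1 -> O -> R) :
  (forall i, measurable_fun setT (a i)) -> (forall i, measurable_fun setT (b i)) ->
  measurable_fun setT (fun o => sqdist (a ^~ o) (b ^~ o)).
Proof.
move=> ma mb; apply: measurable_sum => i.
by apply: measurable_funX; exact: measurable_funB.
Qed.

Lemma measurable_pair_sqdist g : G0 g -> measurable_fun setT (pair_sqdist g).
Proof.
move=> [mg _ _].
apply: (measurable_sqdist (fun i z => g i z.1) (fun i z => g i z.2)) => i.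
  exact: measurableT_comp (mg i) measurable_fst.
exact: measurableT_comp (mg i) measurable_snd.
Qed.

Lemma pair_sqdist_itv g z : G0 g -> 0 <= pair_sqdist g z <= 2.
Proof. by move=> Gg; rewrite sqdist_ge0/= sqdist_le2//; exact: G0_prob. Qed.

Variable v : 'I_d.+1 -> 'rV[R]_d.
Hypotheses (rv : regular_simplex v) (d0 : (0 < d)%N).

(** On the simplex [psi] takes its values in [[-1, 1]], so the hinge is inactive. *)
Lemma loss_barycentric g w : G0 g ->
  loss v (combine v g) w = if w.2 then pair_sqdist g w.1 else 2 - pair_sqdist g w.1.
Proof.
move=> Gg; have /andP[N0 N2] := pair_sqdist_itv g w.1 Gg.
have [_ _ g1] := Gg.
rewrite /loss /rho /combine psi_barycentric ?g1// -/(pair_sqdist g w.1).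
case: w.2; rewrite /= ?mul1r ?mulN1r.
  by rewrite (_ : 1 - _ = pair_sqdist g w.1) ?max_r//; ring.
by rewrite (_ : 1 - _ = 2 - pair_sqdist g w.1) ?max_r ?subr_ge0//; ring.
Qed.

Lemma loss_itv g (w : sample R K) : G0 g -> 0 <= loss v (combine v g) w <= 2.
Proof.
move=> Gg; rewrite loss_barycentric//; have /andP[N0 N2] := pair_sqdist_itv g w.1 Gg.
by case: w.2; rewrite ?N0 ?N2// subr_ge0 N2 gerBl N0.
Qed.

Lemma measurable_loss g :
  G0 g -> measurable_fun [set: sample R K] (loss v (combine v g)).
Proof.
move=> Gg; rewrite (_ : loss v _ = fun w : X * X * bool =>
    if w.2 then pair_sqdist g w.1 else 2 - pair_sqdist g w.1).
  have mN := measurable_pair_sqdist g Gg.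
  have mN2 : measurable_fun setT (fun z => 2 - pair_sqdist g z).
    exact: measurable_funB.
  by have := measurable_fun_if_pair mN mN2; exact.
by apply/funext => w; exact: loss_barycentric.
Qed.

End barycentric_loss.

(** Here [a >= b] are the densities of the two labels at a pair of points, [N] is
    the loss on the likelier label and [r] is the level [s] times [a + b].  The
    gain [N * (a - b)] exceeds [r * N] as soon as [a - b > r]; otherwise the
    last term makes up for it, as [N <= 2]. *)
Lemma hinge_gap {R : realFieldType} (a b r N : R) : 0 <= r -> 0 <= N <= 2 -> b <= a ->
  r * N + 2 * b <= N * a + (2 - N) * b + 2 * r * (`|a - b| <= r)%R%:R.
Proof.
move=> r0 /andP[N0 N2] ba; rewrite ger0_norm ?subr_ge0//.
case: (leP (a - b) r) => [_|rab] /=.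
  have : 0 <= N * (a - b) by rewrite mulr_ge0// subr_ge0.
  have : 0 <= r * (2 - N) by rewrite mulr_ge0// subr_ge0.
  by rewrite mulr1; lra.
have : 0 <= N * (a - b - r) by rewrite mulr_ge0// subr_ge0 ltW.
by rewrite mulr0; lra.
Qed.

(** * Clusters and the excess risk of a distribution in the class *)

Lemma continuous_cube_measurable {R : realType} {K : nat} (f : cube R K -> R) :
  continuous f -> measurable_fun setT f.
Proof.
move=> /continuousP cf; apply: (measurability _ (RGenOpens.measurableE R)).
move=> _ [_ [a [b ->] <-]]; rewrite setTI; apply: sub_sigma_algebra.
exact/cf/interval_open.
Qed.

Section clusters.
Context {R : realType} (xi : params R).
Local Notation d := (sdim xi).
Local Notation X := (cube R (dimX xi)).
Local Notation mu := (@lebesgue_cube R (dimX xi)).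
Local Notation mu2 := (mu \x mu)%E.
Implicit Types g : 'I_d.+1 -> X -> R.
Variables (P : probability (sample R (dimX xi)) R) (T : 'I_d.+1 -> set X).
Variables (p : sample R (dimX xi) -> R) (pX pX' : X -> R) (alpha : R).
Hypotheses (Hxi : Xi xi) (Hs : density_structure P p pX pX')
  (Hr : density_regularity xi p pX pX') (Hc : cluster_structure alpha P p T).

Let Pmu : P `<< (mu2 \x counting)%E. Proof. by case: Hs => -[]. Qed.
Let Pp : is_density P p. Proof. by case: Hs => -[]. Qed.
Let mp : measurable_fun setT p. Proof. by case: Pp. Qed.
Let p0 z : 0 <= p z. Proof. by case: Pp. Qed.
Let mpX : measurable_fun setT pX.
Proof. by case: Hr => _ _ [c _ _] _ _; exact: continuous_cube_measurable. Qed.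
Let mpX' : measurable_fun setT pX'.
Proof. by case: Hr => _ _ _ [c _ _] _; exact: continuous_cube_measurable. Qed.
Let pX_gt0 x : 0 < pX x. Proof. by case: Hr => _ _ []. Qed.
Let pX'_gt0 x : 0 < pX' x. Proof. by case: Hr => _ _ _ []. Qed.
Let theta2_gt0 : 0 < theta2 xi. Proof. by case: Hxi => _ _ _ /andP[]. Qed.
Let pXX0 z : 0 <= p_XX p z. Proof. exact: addr_ge0. Qed.

Lemma label_false_lower_bound x x' :
  theta2 xi * (pX x * pX' x') <= p (x, x', false).
Proof.
have [_ _ _ _ ->] := Hs.
have [x0 x0'] := (ltW (pX_gt0 x), ltW (pX'_gt0 x')).
rewrite -mulrA ler_wpM2r ?mulr_ge0//.
by case: Hr => _ _ _ _ /andP[].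
Qed.

Lemma label_false_gt0 z : 0 < p (z, false).
Proof.
case: z => x x'; apply: lt_le_trans (label_false_lower_bound x x').
by rewrite !mulr_gt0.
Qed.

Lemma cluster_index : exists c : X -> 'I_d.+1, forall x i, T i x <-> c x = i.
Proof.
have [[tT UT _] _ _] := Hc.
have ex x : exists i, T i x by have : setT x by []; rewrite -UT => -[i _ ?]; exists i.
have [c cP] := choice ex; exists c => x i; split=> [Tix|<-]; last exact: cP.
by apply: (tT (c x) i I I); exists x.
Qed.

(** Pairs within a cluster are those whose likelier label is 1: this is how
    the partition determines the sign of [2 * eta - 1]. *)
Lemma same_clusterE (c : X -> 'I_d.+1) : (forall x i, T i x <-> c x = i) ->
  forall z, (c z.1 == c z.2) = (p (z, false) <= p (z, true)).
Proof.
move=> cP z; have [_ _ /seteqP[le ge]] := Hc.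
have q0 : 0 < p_XX p z by rewrite ltr_wpDl// label_false_gt0.
have etaE : (1 / 2 <= eta p z) = (p (z, false) <= p (z, true)).
  rewrite /eta ler_pdivlMr// mulrC mulrA mulr1 ler_pdivrMr//.
  by rewrite /p_XX mulrDr !mulr1; apply/idP/idP; lra.
rewrite -etaE; apply/eqP/idP => [cz|h].
  by apply: ge; exists (c z.2) => //; split; apply/cP.
by have [i _ [/cP -> /cP ->]] := le z h.
Qed.

(** The clusters inherit measurability from [eta]: a nonempty cluster is the
    section, at any of its points, of the set of pairs where [eta >= 1/2]. *)
Lemma measurable_cluster i : measurable (T i).
Proof.
have [c cP] := cluster_index.
have mE : measurable [set z | p (z, false) <= p (z, true)].
  rewrite -[X in measurable X]setTI.
  apply: (measurable_fun_le (f := fun z => p (z, false))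
    (g := fun z => p (z, true))) => //; exact: measurable_slice.
have [->|/set0P[x Tix]] := eqVneq (T i) set0; first exact: measurable0.
rewrite (_ : T i = xsection [set z | p (z, false) <= p (z, true)] x).
  exact: measurable_xsection.
apply/seteqP; split => y; rewrite /xsection/= inE/= -(same_clusterE c cP (x, y))/=.
  by move=> /cP ->; apply/eqP/cP.
by move=> /eqP cxy; apply/cP; rewrite -cxy; apply/cP.
Qed.

Lemma cluster_indicE (c : X -> 'I_d.+1) : (forall x i, T i x <-> c x = i) ->
  forall x i, \1_(T i) x = vertex (c x) i :> R.
Proof.
move=> cP x i; rewrite /vertex indicE; congr (_%:R); congr nat_of_bool.
by apply/idP/eqP => [/set_mem/cP ->//|->]; apply/mem_set/cP.
Qed.

Lemma cluster_G0 : G0 (fun i => \1_(T i) : X -> R).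
Proof.
have [c cP] := cluster_index; split.
- by move=> i; apply: measurable_indic; exact: measurable_cluster.
- by move=> i x; rewrite indicE; case: (_ \in _); rewrite /= ?lexx ?ler01.
- by move=> x; under eq_bigr do rewrite (cluster_indicE c)//; exact: (vertex_prob _).2.
Qed.

(** By the symmetry of [q]. *)
Lemma marginals_agree : {ae mu, forall x, pX x = pX' x}.
Proof.
have [_ _ [m1 m2] _ _] := Hs; have [qs _ _ _ _] := Hr.
move: m1 m2; apply: filterS2 => x e1 e2; apply: EFin_inj; rewrite e1 e2.
by apply: eq_integral => y _; rewrite qs.
Qed.

Lemma other_clusters_mass i :
  ((1 - theta3 xi)%:E <= \int[mu]_y ((y \notin T i)%:R * pX' y)%:E)%E.
Proof.
have mT := measurable_cluster i.
have [_ mar _ _ _] := Hs; have [_ Tle _] := Hc.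
have ind y : (y \notin T i)%:R = \1_(~` T i) y :> R by rewrite indicE in_setC.
have mCT : measurable (~` T i) by exact: measurableC.
rewrite (ge0_ae_eq_integral (g := fun y => (\1_(~` T i) y * pX y)%:E))//.
- rewrite -(integral_P_X _ _ Pmu Pp _ pX pX')// => [|x]; last exact: ltW.
  rewrite integral_indic// setIT.
  suff : ((1 - theta3 xi)%:E <= P_X P (~` T i))%E by [].
  by rewrite probability_setC// EFinB leeB.
- apply/measurable_EFinP; apply: measurable_funM => //.
  by under eq_fun do rewrite ind; exact: measurable_indic.
- by apply/measurable_EFinP; apply: measurable_funM => //; exact: measurable_indic.
- by move=> y _; rewrite lee_fin mulr_ge0// ltW.
- by move=> y _; rewrite lee_fin mulr_ge0// ltW.
have := marginals_agree; apply: filterS => y e _.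
by rewrite ind e.
Qed.

Definition cluster_sqdist (g : 'I_d.+1 -> X -> R) (x : X) : R :=
  sqdist (g ^~ x) (fun i => \1_(T i) x).

Lemma measurable_cluster_sqdist g : G0 g -> measurable_fun setT (cluster_sqdist g).
Proof.
move=> [mg _ _]; apply: (measurable_sqdist g (fun i x => \1_(T i) x)) => // i.
by apply: measurable_indic; exact: measurable_cluster.
Qed.

Let gT : 'I_d.+1 -> X -> R := fun i => \1_(T i).

Lemma pair_sqdist_cluster (c : X -> 'I_d.+1) : (forall x i, T i x <-> c x = i) ->
  forall z, pair_sqdist gT z = 2 * (c z.1 != c z.2)%:R.
Proof.
move=> cP z; rewrite -sqdist_vertex; apply: eq_bigr => i _.
by rewrite /gT !(cluster_indicE c).
Qed.

(** The integrand of [excess_lower_bound].  Within a cluster the likelier label is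
    1 and [hinge_gap] applies to the loss [N]; across clusters it is -1 and
    [hinge_gap] applies to the loss [2 - N]. *)
Lemma pointwise_excess (s : R) g z : 0 <= s -> G0 g ->
  s * `|pair_sqdist g z - pair_sqdist gT z| * p_XX p z +
  (pair_sqdist gT z * p (z, true) + (2 - pair_sqdist gT z) * p (z, false)) <=
  pair_sqdist g z * p (z, true) + (2 - pair_sqdist g z) * p (z, false) +
  2 * s * (\1_[set z | `|p (z, true) - p (z, false)| <= s * p_XX p z] z * p_XX p z).
Proof.
move=> s0 Gg; have [c cP] := cluster_index.
have N0 : 0 <= pair_sqdist g z := sqdist_ge0 _ _.
have N2 : pair_sqdist g z <= 2 by apply: sqdist_le2; exact: G0_prob.
have sq0 : 0 <= s * p_XX p z by rewrite mulr_ge0.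
rewrite (pair_sqdist_cluster c)// (same_clusterE c)// indicE.
have -> : (z \in [set z | `|p (z, true) - p (z, false)| <= s * p_XX p z]) =
    (`|p (z, true) - p (z, false)| <= s * p_XX p z) by apply/idP/idP; rewrite !inE.
set N := pair_sqdist g z in N0 N2 *; set r := s * p_XX p z in sq0 *.
have rE u : s * u * p_XX p z = r * u by rewrite /r mulrAC.
have -> u : 2 * s * (u * p_XX p z) = 2 * r * u by rewrite /r; ring.
rewrite rE.
case: (leP (p (z, false)) (p (z, true))) => pp /=; rewrite ?mulr0 ?mulr1.
  rewrite mul0r !subr0 add0r (ger0_norm N0).
  by apply: hinge_gap => //; rewrite N0.
have N2' : 0 <= 2 - N <= 2 by rewrite subr_ge0 N2 gerBl N0.
have := hinge_gap _ _ _ _ sq0 N2' (ltW pp).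
rewrite (distrC (p (z, false))) (distrC N) (ger0_norm (proj1 (andP N2'))).
by lra.
Qed.

Variable v : 'I_d.+1 -> 'rV[R]_d.
Hypothesis rv : regular_simplex v.

Let d0 : (0 < d)%N. Proof. by case: Hxi => _ []. Qed.

Let Ggt : G0 gT. Proof. exact: cluster_G0. Qed.

Lemma expected_loss g : G0 g ->
  ('E_P[loss v (combine v g)] = \int[mu2]_z
    (pair_sqdist g z * p (z, true) + (2 - pair_sqdist g z) * p (z, false))%:E)%E.
Proof.
move=> Gg; rewrite unlock (integral_sample _ _ Pmu Pp); first last.
- by move=> w; case/andP: (loss_itv v rv d0 g w Gg).
- exact: measurable_loss.
by apply: eq_integral => z _; rewrite !loss_barycentric.
Qed.

Lemma expected_loss_fin g : G0 g -> 'E_P[loss v (combine v g)]%E \is a fin_num.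
Proof.
move=> Gg; rewrite unlock.
have l0 w : (0 <= (loss v (combine v g) w)%:E)%E.
  by rewrite lee_fin; case/andP: (loss_itv v rv d0 g w Gg).
rewrite ge0_fin_numE; last exact: integral_ge0.
apply: (@le_lt_trans _ _ (\int[P]_w (cst 2%:E w))%E); last first.
  by rewrite integral_cst// [X in (_ * X)%E]probability_setT mule1 ltry.
apply: ge0_le_integral => //.
  by apply/measurable_EFinP; exact: measurable_loss.
by move=> w _; rewrite lee_fin; case/andP: (loss_itv v rv d0 g w Gg).
Qed.

(** The level [s = 0] is allowed: it says that [f*] minimizes the risk. *)
Lemma excess_lower_bound (s : R) g : 0 <= s -> G0 g ->
  (s%:E * \int[mu2]_z (`|pair_sqdist g z - pair_sqdist gT z| * p_XX p z)%:E <=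
   excess v T (combine v g) P +
   (2 * s)%:E * P_XX P [set z | (`|p (z, true) - p (z, false)| <= s * p_XX p z)%R])%E.
Proof.
move=> s0 Gg; set A := [set z | _].
have mA : measurable A by exact: measurable_noise_set.
have mN := measurable_pair_sqdist g Gg.
have mNT := measurable_pair_sqdist gT Ggt.
have mpt b := measurable_slice p b mp.
have mq := measurable_p_XX p mp.
have mL (h : 'I_d.+1 -> X -> R) : G0 h -> measurable_fun setT (fun z =>
    (pair_sqdist h z * p (z, true) + (2 - pair_sqdist h z) * p (z, false))%:E).
  move=> Gh; have mh := measurable_pair_sqdist h Gh.
  apply/measurable_EFinP/measurable_funD; apply: measurable_funM => //.
  exact: measurable_funB.
have L0 (h : 'I_d.+1 -> X -> R) z : G0 h ->
    (0 <= (pair_sqdist h z * p (z, true) +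
      (2 - pair_sqdist h z) * p (z, false))%:E)%E.
  move=> Gh; have /andP[N0 N2] := pair_sqdist_itv h z Gh.
  by rewrite lee_fin addr_ge0 ?mulr_ge0// subr_ge0.
have mh : measurable_fun setT (fun z =>
    (`|pair_sqdist g z - pair_sqdist gT z| * p_XX p z)%:E).
  apply/measurable_EFinP/measurable_funM => //.
  by apply: measurableT_comp => //; exact: measurable_funB.
have h0 z : (0 <= (`|pair_sqdist g z - pair_sqdist gT z| * p_XX p z)%:E)%E.
  by rewrite lee_fin mulr_ge0.
have mAq : measurable_fun setT (fun z => (\1_A z * p_XX p z)%:E).
  by apply/measurable_EFinP/measurable_funM => //; exact: measurable_indic.
have Aq0 z : (0 <= (\1_A z * p_XX p z)%:E)%E by rewrite lee_fin mulr_ge0.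
rewrite /excess /fstar addeAC leeBrDr ?expected_loss_fin//.
rewrite !expected_loss// (P_XXE _ _ Pmu Pp)//.
have -> : (\int[mu2]_(z in A) (p_XX p z)%:E = \int[mu2]_z (\1_A z * p_XX p z)%:E)%E.
  rewrite integral_mkcond; apply: eq_integral => z _.
  by rewrite patchE indicE; case: (z \in A); rewrite ?mul1r ?mul0r.
rewrite -!ge0_integralZl// ?lee_fin ?mulr_ge0//.
have sh0 z : (0 <= s%:E * (`|pair_sqdist g z - pair_sqdist gT z| * p_XX p z)%:E)%E.
  by rewrite mule_ge0.
have sA0 z : (0 <= (2 * s)%:E * (\1_A z * p_XX p z)%:E)%E.
  by rewrite mule_ge0// lee_fin mulr_ge0.
have msh := measurable_funeM s%:E mh.
have msA := measurable_funeM (2 * s)%:E mAq.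
have mLg := mL g Gg; have mLT := mL gT Ggt.
rewrite -ge0_integralD//; last by move=> z _; exact: (L0 gT).
rewrite -ge0_integralD//; last by move=> z _; exact: L0.
apply: ge0_le_integral => //.
- by move=> z _; rewrite adde_ge0// (L0 gT).
- exact: emeasurable_funD.
- exact: emeasurable_funD.
- by move=> z _; rewrite -!EFinM -!EFinD lee_fin mulrA; exact: pointwise_excess.
Qed.

(** The factor [pair_sqdist gT z / 2] is the indicator of pairs in different
    clusters.  Only the part of the pair density carried by the label -1 is kept,
    because it is bounded below by a product, to which Tonelli's theorem
    applies. *)
Lemma separation_pointwise (kappa : R) (B : set X) g z : 0 <= kappa -> G0 g ->
  (forall x i, B x -> T i x -> kappa <= g i x) ->
  kappa / 2 * theta2 xi * (\1_B z.1 * cluster_sqdist g z.1 * pX z.1) *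
    (pair_sqdist gT z / 2 * pX' z.2) <=
  `|pair_sqdist g z - pair_sqdist gT z| * p_XX p z.
Proof.
move=> k0 Gg kg; have [c cP] := cluster_index.
have w0 : 0 <= cluster_sqdist g z.1 := sqdist_ge0 _ _.
rewrite (pair_sqdist_cluster c)//; case: (eqVneq (c z.1) (c z.2)) => cz /=.
  by rewrite mulr0 mul0r mul0r mulr0 mulr_ge0.
rewrite mulr1 divff// mul1r indicE.
case: (boolP (z.1 \in B)) => [/set_mem Bz|_] /=; last first.
  by rewrite !mul0r mulr0 mul0r mulr_ge0.
rewrite mul1r.
have -> : kappa / 2 * theta2 xi * (cluster_sqdist g z.1 * pX z.1) * pX' z.2 =
  kappa / 2 * cluster_sqdist g z.1 * (theta2 xi * (pX z.1 * pX' z.2)) by ring.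
have q_ge : theta2 xi * (pX z.1 * pX' z.2) <= p_XX p z.
  apply: (le_trans (label_false_lower_bound _ _)).
  by rewrite /p_XX -surjective_pairing lerDr.
apply: ler_pM => //.
- by rewrite !mulr_ge0.
- by rewrite !mulr_ge0// ltW.
rewrite distrC ger0_norm; last by rewrite subr_ge0; case/andP: (pair_sqdist_itv g z Gg).
have -> : cluster_sqdist g z.1 = sqdist (g ^~ z.1) (vertex (c z.1)).
  by apply: eq_bigr => i _; rewrite (cluster_indicE c).
apply: separation_deficit; [exact: G0_prob|exact: G0_prob|].
by apply: kg => //; apply/cP.
Qed.

(** Integrating [separation_pointwise] over the second point first: whatever the
    first point, the other clusters have mass at least [1 - theta3 xi]. *)
Lemma separation_bound (kappa : R) (B : set X) g : measurable B -> 0 <= kappa -> G0 g ->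
  (forall x i, B x -> T i x -> kappa <= g i x) ->
  ((kappa / 2 * theta2 xi * (1 - theta3 xi))%:E *
     \int[P_X P]_x (\1_B x * cluster_sqdist g x)%:E <=
   \int[mu2]_z (`|pair_sqdist g z - pair_sqdist gT z| * p_XX p z)%:E)%E.
Proof.
move=> mB k0 Gg kg; have [c cP] := cluster_index.
have mw := measurable_cluster_sqdist g Gg.
have mNT := measurable_pair_sqdist gT Ggt.
have mN := measurable_pair_sqdist g Gg.
have w0 x : 0 <= cluster_sqdist g x := sqdist_ge0 _ _.
have [_ mar _ _ _] := Hs.
have t30 : 0 <= 1 - theta3 xi.
  by rewrite subr_ge0; case: Hxi => _ _ _ _ [/andP[_ /ltW //]].
have mBw : measurable_fun setT (fun x => \1_B x * cluster_sqdist g x).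
  by apply: measurable_funM => //; exact: measurable_indic.
rewrite (integral_P_X _ _ Pmu Pp _ pX pX')//; last 2 first.
- by move=> x; exact: ltW.
- by move=> x; rewrite mulr_ge0.
set a := kappa / 2 * theta2 xi.
have a0 : 0 <= a by rewrite !mulr_ge0// ltW.
have u0 x : 0 <= a * (\1_B x * cluster_sqdist g x * pX x).
  by rewrite !mulr_ge0// ltW.
have mpXw : measurable_fun setT (fun x => a * (\1_B x * cluster_sqdist g x * pX x)).
  by apply: measurable_funM => //; exact: measurable_funM.
pose F z := a * (\1_B z.1 * cluster_sqdist g z.1 * pX z.1) *
  (pair_sqdist gT z / 2 * pX' z.2).
have r0 z : 0 <= pair_sqdist gT z / 2 * pX' z.2.
  by rewrite !mulr_ge0 ?sqdist_ge0// ltW.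
have mr : measurable_fun setT (fun z => pair_sqdist gT z / 2 * pX' z.2).
  apply: measurable_funM; first exact: measurable_funM.
  exact: measurableT_comp mpX' measurable_snd.
have mF : measurable_fun setT (EFin \o F).
  apply/measurable_EFinP/measurable_funM => //.
  exact: measurableT_comp mpXw measurable_fst.
have F0 z : (0 <= (EFin \o F) z)%E by rewrite lee_fin mulr_ge0.
apply: (@le_trans _ _ (\int[mu2]_z (EFin \o F) z)%E); last first.
  apply: ge0_le_integral => //.
    apply/measurable_EFinP/measurable_funM; last exact: measurable_p_XX.
    by apply: measurableT_comp => //; exact: measurable_funB.
  by move=> z _; rewrite lee_fin; exact: separation_pointwise.
have mBwp : measurable_fun setT (fun x => (\1_B x * cluster_sqdist g x * pX x)%:E).
  by apply/measurable_EFinP; exact: measurable_funM.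
have Bwp0 x : (0 <= (\1_B x * cluster_sqdist g x * pX x)%:E)%E.
  by rewrite lee_fin !mulr_ge0// ltW.
rewrite (fubini_tonelli1 (EFin \o F))//.
rewrite -ge0_integralZl// ?lee_fin ?mulr_ge0//; last exact: ltW.
apply: ge0_le_integral => //.
- by move=> x _; rewrite mule_ge0// lee_fin mulr_ge0.
- exact: measurable_funeM.
- exact: measurable_fun_fubini_tonelli_F.
move=> x _; rewrite /fubini_F.
have -> : (\int[mu]_y (EFin \o F) (x, y) =
    (a * (\1_B x * cluster_sqdist g x * pX x))%:E *
    \int[mu]_y (pair_sqdist gT (x, y) / 2 * pX' y)%:E)%E.
  rewrite -ge0_integralZl ?lee_fin//.
  - apply/measurable_EFinP.
    by have := measurableT_comp mr (pair1_measurable x); exact.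
  - by move=> y _; rewrite lee_fin; exact: (r0 (x, y)).
rewrite -EFinM mulrAC EFinM lee_wpmul2l ?lee_fin//.
apply: (le_trans (other_clusters_mass (c x))).
rewrite le_eqVlt; apply/orP; left; apply/eqP; apply: eq_integral => y _.
rewrite (pair_sqdist_cluster c)//= [2 * _]mulrC mulfK//.
congr ((_%:R * _)%:E); congr nat_of_bool; congr (~~ _).
apply/idP/eqP => [/set_mem/cP ->//|e]; apply/mem_set/cP; by rewrite e.
Qed.

Lemma sq_error_integral g : G0 g ->
  (sq_error T g P = \int[P_X P]_x (cluster_sqdist g x)%:E)%E.
Proof.
move=> Gg; have [mg _ _] := Gg.
have md i : measurable_fun setT (fun x => (g i x - \1_(T i) x) ^+ 2).
  apply: measurable_funX; apply: measurable_funB => //.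
  by apply: measurable_indic; exact: measurable_cluster.
rewrite /sq_error /cluster_sqdist /sqdist.
under [RHS]eq_integral do rewrite -sumEFin.
rewrite ge0_integral_sum//; last 2 first.
- by move=> i; apply/measurable_EFinP; exact: md.
- by move=> i x _; rewrite lee_fin sqr_ge0.
apply: eq_bigr => i _; rewrite unlock /Lnorm.
have sqE (r : R) : (`|r%:E| `^ 2 = (r ^+ 2)%:E)%E.
  by rewrite abse_EFin poweR_EFin powR_mulrn// real_normK// num_real.
under eq_integral do rewrite sqE.
set I := (\int[_]_x _)%E.
have I0 : (0 <= I)%E by apply: integral_ge0 => x _; rewrite lee_fin sqr_ge0.
by rewrite poweR12_sqrt// sqr_sqrte.
Qed.

Lemma cluster_sqdist_le2 g x : G0 g -> cluster_sqdist g x <= 2.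
Proof. by move=> Gg; apply: sqdist_le2; [exact: G0_prob|exact: (G0_prob gT)]. Qed.

Lemma sq_error_le2 g : G0 g -> (sq_error T g P <= 2%:E)%E.
Proof.
move=> Gg; rewrite sq_error_integral//.
apply: (@le_trans _ _ (\int[P_X P]_x (cst 2%:E x))%E); last first.
  by rewrite integral_cst// [X in (_ * X)%E]probability_setT mule1.
apply: ge0_le_integral => //.
- by move=> x _; rewrite lee_fin sqdist_ge0.
- by apply/measurable_EFinP; exact: measurable_cluster_sqdist.
- by move=> x _; rewrite lee_fin; exact: cluster_sqdist_le2.
Qed.

Lemma excess_ge0 g : G0 g -> (0 <= excess v T (combine v g) P)%E.
Proof.
move=> Gg; have := excess_lower_bound 0 g (lexx 0) Gg.
by rewrite mul0e mulr0 mul0e adde0.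
Qed.

Lemma measurable_near_fstar g (beta : R) : 0 < beta -> G0 g ->
  measurable [set x | enorm (combine v g x - fstar v T x) < beta].
Proof.
move=> beta0 Gg; have mw := measurable_cluster_sqdist g Gg.
have [_ _ g1] := Gg; have [_ _ t1] := Ggt.
rewrite (_ : [set x | _] =
    ~` [set x | beta ^+ 2 <= side v ^+ 2 / 2 * cluster_sqdist g x]).
  apply: measurableC; rewrite -[X in measurable X]setTI.
  apply: (measurable_fun_le (f := cst (beta ^+ 2))
    (g := fun x => side v ^+ 2 / 2 * cluster_sqdist g x)) => //.
  exact: measurable_funM.
apply: eq_set => x; apply/propext.
have E : side v ^+ 2 / 2 * cluster_sqdist g x =
    enorm (combine v g x - fstar v T x) ^+ 2.
  apply/esym/(enorm_sqr_barycentric v rv d0 (g ^~ x) (gT ^~ x)).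
  by rewrite g1 t1.
rewrite /= E.
rewrite ler_pXn2r ?nnegrE ?enorm_ge0 ?(ltW beta0)//.
by rewrite ltNge; exact: (iff_sym (rwP negP)).
Qed.

(** The product of the guaranteed coordinate [1 - beta / Dproj v] (halved, see
    [separation_deficit]), of the weight of the label -1 and of the mass outside
    a cluster. *)
Definition separation_constant (beta : R) : R :=
  (1 - beta / Dproj v) / 2 * theta2 xi * (1 - theta3 xi).

Lemma separation_constant_gt0 (beta : R) :
  0 < beta < Dproj v -> 0 < separation_constant beta.
Proof.
move=> /andP[beta0 betaD]; rewrite !mulr_gt0// subr_gt0.
  by rewrite ltr_pdivrMr ?mul1r// (lt_trans beta0).
by case: Hxi => _ _ _ _ [/andP[]].
Qed.

Lemma sq_error_bound (s beta beta0 : R) g : 0 < s -> 0 < beta < Dproj v -> G0 g ->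
  ((1 - beta0)%:E <=
    P_X P [set x | (enorm (combine v g x - fstar v T x) < beta)%R])%E ->
  (sq_error T g P <=
    ((separation_constant beta * s)^-1)%:E * excess v T (combine v g) P +
    ((2 / separation_constant beta)%:E *
       P_XX P [set z | (`|2 * eta p z - 1| <= s)%R] + (2 * beta0)%:E))%E.
Proof.
move=> s0 beta_itv Gg near; set k := separation_constant beta.
pose B := [set x | enorm (combine v g x - fstar v T x) < beta].
have mB : measurable B by apply: measurable_near_fstar => //; case/andP: beta_itv.
have w0 x : 0 <= cluster_sqdist g x := sqdist_ge0 _ _.
have mw := measurable_cluster_sqdist g Gg.
have k0 : 0 < k by exact: separation_constant_gt0.
have kappa0 : 0 <= 1 - beta / Dproj v.
  have [beta0' betaD] := andP beta_itv.
  by rewrite subr_ge0 ler_pdivrMr ?mul1r ?(ltW betaD)// (lt_trans beta0').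
have kg x i : B x -> T i x -> 1 - beta / Dproj v <= g i x.
  move=> Bx Tix; apply: (near_vertex_weight v rv d0 (g ^~ x) i beta beta_itv).
    exact: G0_prob.
  have [c cP] := cluster_index.
  rewrite (_ : v i = fstar v T x)//.
  rewrite /fstar /combine (vertexE v i); apply: eq_bigr => j _.
  by rewrite (cluster_indicE c)// (proj1 (cP x i) Tix).
rewrite sq_error_integral//.
(* outside [B] the error is only bounded by 2 *)
have split_B : (\int[P_X P]_x (cluster_sqdist g x)%:E <=
   \int[P_X P]_x (\1_B x * cluster_sqdist g x)%:E + (2 * beta0)%:E)%E.
  have mBw : measurable_fun setT (fun x => (\1_B x * cluster_sqdist g x)%:E).
    by apply/measurable_EFinP/measurable_funM => //; exact: measurable_indic.
  have mCB : measurable (~` B) by exact: measurableC.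
  have Bw0 x : (0 <= (\1_B x * cluster_sqdist g x)%:E)%E by rewrite lee_fin mulr_ge0.
  have CB0 x : (0 <= 2%:E * (\1_(~` B) x)%:E :> \bar R)%E.
    by rewrite -EFinM lee_fin mulr_ge0.
  have mCB1 : measurable_fun setT (fun x => (\1_(~` B) x)%:E : \bar R).
    by apply/measurable_EFinP; exact: measurable_indic.
  apply: (@le_trans _ _ (\int[P_X P]_x
      ((\1_B x * cluster_sqdist g x)%:E + 2%:E * (\1_(~` B) x)%:E))%E).
    apply: ge0_le_integral => //.
    - by move=> x _; rewrite lee_fin.
    - exact/measurable_EFinP.
    - by apply: emeasurable_funD => //; exact: measurable_funeM.
    - move=> x _; rewrite -EFinM -EFinD lee_fin !indicE in_setC.
      case: (x \in B); rewrite /= ?mul1r ?mulr0 ?addr0// mul0r add0r mulr1.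
      exact: cluster_sqdist_le2.
  rewrite ge0_integralD//; last exact: measurable_funeM.
  rewrite leeD2l// ge0_integralZl//; last first.
  rewrite integral_indic// setIT EFinM lee_pmul2l//.
  suff : (P_X P (~` B) <= beta0%:E)%E by [].
  rewrite probability_setC// leeBlDr ?fin_num_measure//.
  by rewrite addeC -leeBlDr// -EFinB.
have sepB := separation_bound _ B g mB kappa0 Gg kg.
have exB := excess_lower_bound s g (ltW s0) Gg.
rewrite noise_setE//; last exact: label_false_gt0.
set nu := P_XX P _ in exB *; set exc := excess _ _ _ _ in exB *.
have nu0 : (0 <= nu)%E by exact: measure_ge0.
have exc0 : (0 <= exc)%E by exact: excess_ge0.
apply: (le_trans split_B); rewrite addeA leeD2r//.
rewrite -lee_pdivlMl// in sepB; rewrite -lee_pdivlMl// in exB.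
apply: (le_trans sepB).
apply: (@le_trans _ _ (k^-1%:E * (s^-1%:E * (exc + (2 * s)%:E * nu)))%E).
  by rewrite lee_pmul2l// lte_fin invr_gt0.
rewrite muleA -EFinM -invfM ge0_muleDr//; last first.
  by rewrite mule_ge0// lee_fin mulr_ge0// ltW.
rewrite muleA -EFinM [_ * (2 * s)](_ : _ = 2 / k)//.
by field; rewrite !gt_eqF.
Qed.

End clusters.

(** * Choice of the noise level *)

(** The level [e `^ (1 - 1 / tau)] balances the two terms of [sq_error_bound]. *)
Lemma noise_tradeoff {R : realType} (tau e : R) : 1 < tau -> 0 < e <= 1 ->
  exists2 s, 0 < s <= 1 & e / s = e `^ (1 / tau) /\ s `^ (tau - 1)^-1 = e `^ (1 / tau).
Proof.
move=> tau1 /andP[e0 e1]; have tau0 : 0 < tau by exact: lt_trans tau1.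
exists (e `^ (1 - 1 / tau)).
  rewrite powR_gt0//= -[leRHS](powRr0 e); apply: ger_powR; rewrite ?e0//.
  by rewrite subr_ge0 ler_pdivrMr// mul1r ltW.
split.
  by rewrite -{1}(powRr1 (ltW e0)) -powRB ?(gt_eqF e0) ?implybT// opprB addrC subrK.
rewrite -powRrM; congr (_ `^ _); field.
by rewrite gt_eqF//= subr_eq0 gt_eqF.
Qed.

Lemma integral_affine_le {R : realType} {d} {O : measurableType d}
    (Pr : probability O R) (X Y : O -> \bar R) (a b : R) :
  measurable_fun setT X -> measurable_fun setT Y ->
  (forall w, 0 <= X w)%E -> (forall w, 0 <= Y w)%E -> 0 <= a -> 0 <= b ->
  (forall w, X w <= a%:E * Y w + b%:E)%E ->
  (\int[Pr]_w X w <= a%:E * \int[Pr]_w Y w + b%:E)%E.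
Proof.
move=> mX mY X0 Y0 a0 b0 XY.
apply: (@le_trans _ _ (\int[Pr]_w (a%:E * Y w + (cst b%:E) w))%E).
  apply: ge0_le_integral => //.
  by apply: emeasurable_funD => //; exact: measurable_funeM.
have aY0 w : (0 <= a%:E * Y w)%E by rewrite mule_ge0.
have maY := measurable_funeM a%:E mY.
have cb0 (w : O) : (0 <= cst b%:E w)%E by rewrite lee_fin.
rewrite ge0_integralD//.
rewrite ge0_integralZl// integral_cst// [X in (_ + _ * X)%E]probability_setT mule1.
exact: lexx.
Qed.

(** Three regimes.  If [1 <= e] the bound [r <= 2] suffices.  If [tau = 1], almost no
    pair has [|2 * et - 1| <= theta / 2], and this level gives a linear bound.
    If [tau > 1] and [e < 1], the level is that of [noise_tradeoff], unless
    [e = 0]: then the best level would be 0, and a level at which the noise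
    term is of order [1 / n] is taken instead. *)
Lemma optimal_noise_level {R : realType} {K : nat} (P : probability (sample R K) R)
    (et : cube R K * cube R K -> R) (tau theta k b : R) (n : nat) (r e : \bar R) :
  1 <= tau -> 0 < theta <= 1 -> 0 < k -> 0 <= b -> (1 < n)%N ->
  noise_condition tau theta P et -> (0 <= e)%E -> (r <= 2%:E)%E ->
  (forall s : R, (0 < s)%R -> r <= ((k * s)^-1)%:E * e +
    ((2 / k)%:E * P_XX P [set z | (`|2 * et z - 1| <= s)%R] + b%:E))%E ->
  (r <= ((2 / (k * theta) + 1 / k + 2) / ln 2 * ln n%:R)%:E * e `^ (1 / tau)%R +
        b%:E + ((2 / (k * theta)) / n%:R)%:E)%E.
Proof.
move=> tau1 /andP[th0 th1] k0 b0 n1 noise e0 r2 rs.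
have tau0 : 0 < tau by exact: lt_le_trans tau1.
have n0 : 0 < n%:R :> R by rewrite ltr0n (ltn_trans _ n1).
have k20 : 0 <= 2 / k by rewrite divr_ge0// ltW.
have kt0 : 0 <= 2 / (k * theta) by rewrite divr_ge0// ltW// mulr_gt0.
have k10 : 0 <= 1 / k by rewrite divr_ge0// ltW.
have ln2 : 0 < ln 2 :> R by rewrite ln_gt0// ltr1n.
set C := 2 / (k * theta) + 1 / k + 2.
have C0 : 0 <= C by rewrite !addr_ge0.
have Cn : C <= C / ln 2 * ln n%:R.
  rewrite -mulrA ler_peMr// mulrC ler_pdivlMr// mul1r ler_ln ?posrE//.
  by rewrite ler_nat.
have p0 : (0 <= e `^ (1 / tau))%E by exact: poweR_ge0.
have tail0 : (0 <= b%:E + ((2 / (k * theta)) / n%:R)%:E)%E.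
  by rewrite -EFinD lee_fin addr_ge0// divr_ge0// ltW.
suff main : (r <= C%:E * e `^ (1 / tau)%R + (b%:E + ((2 / (k * theta)) / n%:R)%:E))%E.
  apply: (le_trans main); rewrite -addeA leeD2r//.
  by rewrite lee_wpmul2r// lee_fin.
have itau0 : 0 < 1 / tau by rewrite divr_gt0.
have [e1|e1] := leP 1%E e.
  apply: (le_trans r2).
  apply: (@le_trans _ _ (C%:E * e `^ (1 / tau))%E); last by rewrite leeDl.
  have : (1 <= e `^ (1 / tau))%E.
    case: e e1 {rs e0 p0} => [e| |] //= e1.
      by rewrite lee_fin -[leLHS](powRr0 e); apply: ler_powR => //; exact: ltW.
    by rewrite gt_eqF// leey.
  move=> p1; apply: (@le_trans _ _ (C%:E * 1)%E); last by rewrite lee_wpmul2l ?lee_fin.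
  by rewrite mule1 lee_fin /C lerDr addr_ge0.
case: e e0 e1 p0 rs => [e| |] //; rewrite lee_fin lte_fin => e0 e1 p0 rs.
rewrite poweR_EFin.
have ep0 : 0 <= e `^ (1 / tau) by exact: powR_ge0.
case: noise => [[tau_gt1 [c /andP[c1 cth] noise]]|[tau_eq1 [s0 /andP[s0th s01] noise]]].
  have c0 : 0 <= c by exact: le_trans c1.
  have ck : 2 / k * c <= 2 / (k * theta).
    by rewrite invfM [leRHS]mulrA ler_wpM2l.
  have level s : 0 < s <= 1 ->
      (r <= ((k * s)^-1 * e + (2 / (k * theta) * s `^ (tau - 1)^-1 + b))%:E)%E.
    move=> /andP[sp sle]; apply: (le_trans (rs s sp)).
    rewrite !EFinD -!EFinM leeD2l// leeD2r// EFinM.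
    have := noise s; rewrite sp sle => /(_ isT).
    rewrite /noise_pow gt_eqF// => ns.
    apply: (@le_trans _ _ ((2 / k)%:E * (c * s `^ (tau - 1)^-1)%:E)%E).
      by rewrite lee_wpmul2l ?lee_fin.
    by rewrite -!EFinM lee_fin mulrA ler_wpM2r// powR_ge0.
  have [en0|ep] := eqVneq e 0.
    (* this level has power [(tau - 1)^-1] equal to [1 / n] *)
    have sp : 0 < (n%:R^-1 : R) `^ (tau - 1) <= 1.
      rewrite powR_gt0 ?invr_gt0//= -[leRHS](powRr0 (n%:R^-1)); apply: ger_powR.
        by rewrite invr_gt0 n0/= invf_le1// ler1n (ltn_trans _ n1).
      by rewrite subr_ge0.
    apply: (le_trans (level _ sp)).
    rewrite -powRrM divff ?subr_eq0 ?gt_eqF// powRr1 ?invr_ge0 ?(ltW n0)//.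
    rewrite en0 mulr0 add0r powR0 ?gt_eqF// mule0 add0e -EFinD lee_fin.
    by rewrite addrC.
  have egt0 : 0 < e by rewrite lt_neqAle eq_sym ep.
  have [|s s_itv [es ns]] := noise_tradeoff tau e tau_gt1; first by rewrite egt0 ltW.
  apply: (le_trans (level s s_itv)).
  have -> : (k * s)^-1 * e = 1 / k * (e / s).
    by rewrite invfM mul1r -mulrA [s^-1 * e]mulrC.
  rewrite ns es -EFinM -!EFinD lee_fin /C.
  have : 0 <= 2 / (k * theta) / n%:R by rewrite divr_ge0// ltW.
  by move: ep0; nra.
have th2 : 0 < theta / 2 by rewrite divr_gt0.
have thlt1 : theta / 2 < 1 by lra.
apply: (le_trans (rs _ th2)).
have := noise (theta / 2) 1; rewrite th2/= => /(_ _ (lexx 1)).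
have le0 : theta / 2 <= s0 by lra.
move=> /(_ le0); rewrite /noise_pow tau_eq1 eqxx (lt_eqF thlt1) mulr0 => nu0.
have -> : P_XX P [set z | `|2 * et z - 1| <= theta / 2] = 0%E.
  by apply/eqP; rewrite eq_le nu0 measure_ge0.
rewrite mule0 add0e divr1 powRr1// -!EFinM -!EFinD lee_fin.
have -> : (k * (theta / 2))^-1 = 2 / (k * theta).
  by field; rewrite !gt_eqF.
have : 0 <= 2 / (k * theta) / n%:R by rewrite divr_ge0// ltW.
by rewrite /C; nra.
Qed.

(** * The risk bound *)

Lemma measurable_joint {R : realType} {d d'} {O : measurableType d}
    {Z : measurableType d'} (Pr : probability O R) (n : nat)
    (U : 'I_n -> {RV Pr >-> Z}) :
  measurable_fun setT (joint U).
Proof.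
apply/measurable_fun_tnthP => i.
rewrite (_ : _ \o _ = U i); first exact: measurable_funPT.
by apply/funext => w /=; rewrite tnth_mktuple.
Qed.

Lemma noise_condition_version {R : realType} {K : nat} (P : probability (sample R K) R)
    (p p' : sample R K -> R) (tau theta : R) :
  P `<< (lebesgue_cube R K \x lebesgue_cube R K \x counting)%E ->
  is_density P p -> is_density P p' ->
  (forall z, 0 < p (z, false)) -> (forall z, 0 < p' (z, false)) ->
  noise_condition tau theta P (eta p) -> noise_condition tau theta P (eta p').
Proof.
move=> Pmu Pp Pp' p0 p0'; rewrite /noise_condition.
have E s := noise_mass_version P p p' s Pmu Pp Pp' p0 p0'.
case=> [[t1 [c c1 nc]]|[t1 [s0 s01 nc]]]; [left|right]; split=> //.
  by exists c => // s s1; rewrite -E; exact: nc.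
by exists s0 => // s c s1 c1; rewrite -E; exact: nc.
Qed.

Theorem theorem4p12 (R : realType) (xi : params R)
    (v : 'I_(sdim xi).+1 -> 'rV[R]_(sdim xi))
    (S : probability (sample R (dimX xi)) R ->
         'I_(sdim xi).+1 -> set (cube R (dimX xi)))
    (F : set (cube R (dimX xi) -> 'rV[R]_(sdim xi)))
    (tau beta beta0 : R) :
  Xi xi -> regular_simplex v -> is_selection S ->
  F `<=` F0 v -> 1 <= tau -> 0 < beta < Dproj v -> 0 <= beta0 ->
  exists C C' C'' : R, [/\ 0 < C, 0 < C', 0 < C'' &
  forall (n : nat) (P : probability (sample R (dimX xi)) R),
  (1 < n)%N -> class_tau xi tau P ->
  forall (dO : measure_display) (Omega : measurableType dO)
    (Pr : probability Omega R) (U : 'I_n -> {RV Pr >-> sample R (dimX xi)}),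
  iid U P ->
  forall (fhat : n.-tuple (sample R (dimX xi)) ->
                 cube R (dimX xi) -> 'rV[R]_(sdim xi))
    (ghat : n.-tuple (sample R (dimX xi)) ->
            'I_(sdim xi).+1 -> cube R (dimX xi) -> R),
  (forall u, localized v beta beta0 P (S P) F (fhat u)) ->
  (forall u, G0 (ghat u)) ->
  (forall u, fhat u = combine v (ghat u)) ->
  measurable_fun setT (fun u => excess v (S P) (fhat u) P) ->
  measurable_fun setT (fun u => sq_error (S P) (ghat u) P) ->
  (risk U (S P) ghat P <=
   (C * ln n%:R)%R%:E * expected_excess U v (S P) fhat P `^ (1 / tau)%R +
   (C' * beta0)%R%:E + (C'' / n%:R)%R%:E)%E].
Proof.
move=> Hxi rv selS FF0 tau1 beta_itv beta00.
have th_itv : 0 < thetaNC xi <= 1 by case: Hxi.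
pose k := separation_constant xi v beta.
have k0 : 0 < k by exact: separation_constant_gt0.
pose tail := 2 / (k * thetaNC xi).
have th0 : 0 < thetaNC xi by case/andP: th_itv.
have tail0 : 0 < tail by rewrite divr_gt0// mulr_gt0.
have ln2 : 0 < ln 2 :> R by rewrite ln_gt0// ltr1n.
exists ((tail + 1 / k + 2) / ln 2), 2, tail; split => //.
  by rewrite divr_gt0// !addr_gt0// divr_gt0.
move=> n P n1 Ptau dO O Pr U _ fhat ghat loc Gg fg mexc msq.
have [alpha' [tau' [_ _ [p [pX [pX' [Hs _ Hr Hc]]]]]]] : exists alpha tau : R,
    [/\ 0 < alpha, 1 <= tau & admissible alpha tau P (S P)].
  by apply: selS; exists tau.
have noise : noise_condition tau (thetaNC xi) P (eta p).
  case: Ptau => alpha _ [S0 [p0 [pX0 [pX0' [Hs0 noise0 Hr0 Hc0]]]]].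
  apply: noise_condition_version noise0; try by [case: Hs => -[]|case: Hs0 => -[]].
    exact: (label_false_gt0 _ _ _ _ _ Hxi Hs0 Hr0).
  exact: (label_false_gt0 _ _ _ _ _ Hxi Hs Hr).
have mj := measurable_joint Pr n U.
(* the level [s] is still free here; it is fixed once the bound is integrated *)
have bound (s : R) u : 0 < s ->
  (sq_error (S P) (ghat u) P <= ((k * s)^-1)%:E * excess v (S P) (fhat u) P +
    ((2 / k)%:E * P_XX P [set z | (`|2 * eta p z - 1| <= s)%R] + (2 * beta0)%:E))%E.
  move=> s0; rewrite fg.
  apply: (sq_error_bound _ _ _ _ _ _ _ Hxi Hs Hr Hc
    _ rv s beta beta0 _ s0 beta_itv (Gg u)).
  by have [_] := loc u; rewrite fg.
have exc0 u : (0 <= excess v (S P) (fhat u) P)%E.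
  by rewrite fg; exact: (excess_ge0 _ _ _ _ _ _ _ Hxi Hs Hr Hc).
have risk_le a b : 0 <= a -> 0 <= b ->
    (forall u, sq_error (S P) (ghat u) P <=
      a%:E * excess v (S P) (fhat u) P + b%:E)%E ->
    (risk U (S P) ghat P <= a%:E * expected_excess U v (S P) fhat P + b%:E)%E.
  move=> a0 b0 le; apply: integral_affine_le => //.
  - exact: (measurableT_comp msq mj).
  - exact: (measurableT_comp mexc mj).
  - by move=> w; apply: sume_ge0 => i _; rewrite expe_ge0 ?Lnorm_ge0.
apply: (optimal_noise_level P (eta p) tau (thetaNC xi) k (2 * beta0)) => //.
- by rewrite mulr_ge0.
- by apply: integral_ge0 => w _; exact: exc0.
- have := risk_le 0 2 (lexx 0) _ _; rewrite mul0e add0e; apply=> // u.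
  by rewrite mul0e add0e; exact: (sq_error_le2 _ _ _ _ _ _ _ Hxi Hs Hr Hc).
move=> s s0.
have [mp p_ge0 _] : is_density P p by case: Hs => -[].
have mA : measurable [set z | `|2 * eta p z - 1| <= s].
  rewrite noise_setE//; first exact: measurable_noise_set.
  exact: (label_false_gt0 _ _ _ _ _ Hxi Hs Hr).
have := bound s ^~ s0; set nu := P_XX P _ => bound_s.
have nu_fin : nu \is a fin_num by exact: fin_num_measure.
have nu0 : (0 <= nu)%E by exact: measure_ge0.
rewrite -(fineK nu_fin) -EFinM -EFinD.
apply: risk_le.
- by rewrite invr_ge0 mulr_ge0// ltW.
- by rewrite addr_ge0 ?mulr_ge0 ?fine_ge0// invr_ge0 ltW.
- by move=> u; rewrite EFinD EFinM fineK.
Qed.
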